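(* Let $f$ be a non-zero modular function for $\mathrm{SL}_2(\mathbb{Z})$ of real weight $k<0$, holomorphic on the upper half plane $\mathfrak{H}$, with expansion $f(z)=\sum_{\lambda\in\Lambda}a(\lambda)e^{2\pi i\lambda z}$ at $\infty$. Then there exists $\lambda_0\in\mathbb{R}$ such that $a(\lambda)\neq0$ for all $\lambda\geqslant\lambda_0$ in $\Lambda$.
   Context: $\mathfrak{H}=\{z\in\mathbb{C}:\mathrm{Im}(z)>0\}$. A holomorphic function $f$ on $\mathfrak{H}$ is a modular function of real weight $k$ for $\mathrm{SL}_2(\mathbb{Z})$ if: for every $\gamma=\begin{pmatrix}a&b\\c&d\end{pmatrix}\in\mathrm{SL}_2(\mathbb{Z})$ one has $f(\gamma z)=j(\gamma,z)f(z)$, where $\gamma z=\frac{az+b}{cz+d}$ and $j(\gamma,\cdot)$ is a holomorphic function on $\mathfrak{H}$ with $|j(\gamma,z)|=|cz+d|^k$; and $f$ has finite order at the cusps. The function $j\left(\begin{pmatrix}1&1\\0&1\end{pmatrix},z\right)$ is a constant $u$ with $|u|=1$, so $f(z+1)=u f(z)$ and $f$ has a unique expansion $f(z)=\sum_{\lambda\in\Lambda}a(\lambda)e^{2\pi i\lambda z}$ with $\Lambda=\{\lambda\in\mathbb{R}:e^{2\pi i\lambda}=u\}$; the finite order condition means that there are only finitely many $\lambda<0$ in $\Lambda$ with $a(\lambda)\ne0$. *)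

(* Defs.v *)
From Stdlib Require Export Reals ZArith List.
From Coquelicot Require Export Coquelicot.

Open Scope R_scope.

Definition upper_half_plane (z : C) : Prop := 0 < Im z.

Definition holomorphic_on_H (f : C -> C) : Prop :=
  forall z : C, upper_half_plane z -> @ex_derive C_AbsRing C_NormedModule f z.

Definition Cexp (z : C) : C := (exp (Re z) * cos (Im z), exp (Re z) * sin (Im z)).

(* z |-> exp (2 pi i z) *)
Definition e2pi (z : C) : C := Cexp (RtoC (2 * PI) * Ci * z)%C.

Record SL2Z : Set := mkSL2Z {
  ma : Z; mb : Z; mc : Z; md : Z;
  det_eq_1 : (ma * md - mb * mc = 1)%Z
}.

Definition T_mat : SL2Z := mkSL2Z 1 1 0 1 eq_refl.

Definition denom (g : SL2Z) (z : C) : C :=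
  (RtoC (IZR (mc g)) * z + RtoC (IZR (md g)))%C.

Definition mobius (g : SL2Z) (z : C) : C :=
  ((RtoC (IZR (ma g)) * z + RtoC (IZR (mb g))) / denom g z)%C.

(* Unordered summation over a set S of real indices: the sums over finite
   subsets of S, listed without repetition, converge to s along inclusion. *)
Definition has_sum (S : R -> Prop) (g : R -> C) (s : C) : Prop :=
  forall eps : R, 0 < eps ->
  exists l0 : list R,
    List.Forall S l0 /\
    forall l : list R, NoDup l -> List.Forall S l -> incl l0 l ->
      Cmod (Iter.iter Cplus (RtoC 0) l g - s)%C < eps.

(* In applications u is the constant with f (z + 1) = u f (z). *)
Definition exponents (u : C) (lambda : R) : Prop := e2pi (RtoC lambda) = u.

(* Values of a outside exponents u play no role. *)
Definition expansion_at_oo (u : C) (f : C -> C) (a : R -> C) : Prop :=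
  forall z : C, upper_half_plane z ->
    has_sum (exponents u) (fun lambda => a lambda * e2pi (RtoC lambda * z))%C (f z).

Definition finite_order_at_oo (u : C) (f : C -> C) : Prop :=
  exists a : R -> C,
    expansion_at_oo u f a /\
    exists l : list R, forall lambda : R,
      exponents u lambda -> lambda < 0 -> a lambda <> RtoC 0 -> In lambda l.

(* For the factors j considered below, j T_mat is holomorphic on the upper half
   plane with |j T_mat z| = 1, hence is constant there; u is its value, read
   off at the base point i. *)
Definition translation_constant (j : SL2Z -> C -> C) : C := j T_mat Ci.

(* Rpower is used at positive arguments only: c z + d does not vanish on the
   upper half plane. *)
Record modular_function (k : R) (j : SL2Z -> C -> C) (f : C -> C) : Prop := {
  mf_holomorphic : holomorphic_on_H f;
  mf_transform : forall (g : SL2Z) (z : C), upper_half_plane z ->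
    f (mobius g z) = (j g z * f z)%C;
  mf_factor_holomorphic : forall g : SL2Z, holomorphic_on_H (j g);
  mf_factor_modulus : forall (g : SL2Z) (z : C), upper_half_plane z ->
    Cmod (j g z) = Rpower (Cmod (denom g z)) k;
  mf_finite_order : finite_order_at_oo (translation_constant j) f
}.

(* Main.v *)
Require Import Defs.
From Stdlib Require Import Lra Lia Psatz Classical.

(* If every nonzero coefficient had exponent [>= 0], then [f] would be bounded
   high up in the upper half plane, so modularity and [k < 0] would give
   [f (x + i y) -> 0] uniformly as [y -> 0], forcing all coefficients to
   vanish. So there is a least exponent [- mu < 0]. For [lambda > 0] large,
   integrate [f (z) e (- lambda z)] over a period at the saddle-point height
   [y = sqrt (mu / lambda)]. By inversion [f (z)] is governed near [z = i y] by
   the term [a (- mu) e (mu / z)], times the automorphy factor, which is a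
   constant times [z^k]. On a short arc around [i y] the phase of this main term
   hardly varies, and its size is about [exp (4 pi mu / y)]; all other
   contributions are smaller by a factor that decays faster than any power of
   [y]. With [y = s^3] an arc of width proportional to [s^4] works. *)

(** Write [t = x / y] at the saddle-point height [y]. Apart from the bounded [k * atan t] of the
    automorphy factor, the phase of the main term is of order [t^3 / y], while its size drops by a
    factor exponential in [t^2 / y]. The drop sets in at [t] about [y^(1/2)]; the phase stays
    bounded up to [t] about [y^(1/3)]. At this larger scale the drop is already exponential in
    [y^(-1/3)], which beats the weight factor [y^(-k)], and [y = s^3] turns all scales into integral
    powers of [s]. No asymptotic evaluation of the integral is needed. After multiplication by a
    suitable constant the main term has nonnegative real part for [|t| <= c * s]. On the shorter arc
    [|t| <= c * s^2] its size stays within a constant factor of the peak, and this arc alone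
    contributes a power of [s] times the peak. Everything else is at most [exp (- kap / s)] times
    the peak, so a vanishing integral is impossible for small [s]. *)

(** * Complex exponentials and the set of exponents *)

Lemma exp_monotone (x y : R) : x <= y -> exp x <= exp y.
Proof. intros [H| ->]; [left; now apply exp_increasing|apply Rle_refl]. Qed.

Lemma Re_minus (z w : C) : Re (z - w)%C = Re z - Re w.
Proof. reflexivity. Qed.

Lemma Cmod_Cexp (z : C) : Cmod (Cexp z) = exp (Re z).
Proof.
  unfold Cmod, Cexp; cbn [fst snd].
  replace (_ + _) with (Rsqr (exp (Re z))).
  - apply sqrt_Rsqr, Rlt_le, exp_pos.
  - pose proof (sin2_cos2 (Im z)) as H; unfold Rsqr in *.
    transitivity (exp (Re z) * exp (Re z) * (sin (Im z) * sin (Im z) + cos (Im z) * cos (Im z))).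
    + rewrite H; ring.
    + ring.
Qed.

Lemma Cexp_plus (z w : C) : Cexp (z + w) = (Cexp z * Cexp w)%C.
Proof.
  destruct z as [x y], w as [x' y'].
  unfold Cexp, Cplus, Cmult; cbn.
  rewrite exp_plus, cos_plus, sin_plus; f_equal; ring.
Qed.

Lemma e2pi_pair (x y : R) :
  e2pi (x, y) = (exp (- (2 * PI * y)) * cos (2 * PI * x), exp (- (2 * PI * y)) * sin (2 * PI * x)).
Proof. unfold e2pi, Cexp; cbn; f_equal; f_equal; f_equal; ring. Qed.

Lemma e2pi_plus (z w : C) : e2pi (z + w) = (e2pi z * e2pi w)%C.
Proof. unfold e2pi; rewrite <- Cexp_plus; f_equal; ring. Qed.

Lemma Cmod_e2pi (z : C) : Cmod (e2pi z) = exp (- (2 * PI * Im z)).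
Proof. unfold e2pi; rewrite Cmod_Cexp; f_equal; destruct z; cbn; ring. Qed.

Lemma scal_pair (m x y : R) : (RtoC m * (x, y))%C = (m * x, m * y).
Proof. unfold Cmult, RtoC; cbn; f_equal; ring. Qed.

Lemma exponents_diff_int (u : C) (l l' : R) :
  exponents u l -> exponents u l' -> exists n : Z, l' - l = IZR n.
Proof.
  unfold exponents, RtoC; rewrite !e2pi_pair; intros H H'.
  rewrite <- H' in H; clear H'; injection H as Hc Hs.
  rewrite Rmult_0_r, Ropp_0, exp_0, !Rmult_1_l in *.
  assert (H1 : cos (2 * (PI * (l' - l))) = 1).
  { replace (2 * (PI * (l' - l))) with (2 * PI * l' - 2 * PI * l) by ring.
    rewrite cos_minus, Hc, Hs, Rplus_comm. apply sin2_cos2. }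
  rewrite cos_2a_sin in H1.
  assert (H2 : sin (PI * (l' - l)) = 0) by nra.
  apply sin_eq_0_0 in H2; destruct H2 as [n Hn].
  exists n. pose proof PI_RGT_0. nra.
Qed.

(** * Unordered sums *)

Lemma NoDup_remove_Req (l : list R) (x : R) : NoDup l -> NoDup (remove Req_dec_T x l).
Proof.
  induction l as [|h l IH]; intros N; [constructor|]. inversion N; subst. cbn.
  destruct (Req_dec_T x h); [auto|]. constructor; [|auto].
  intros Hin; apply in_remove in Hin; tauto.
Qed.

Lemma iter_remove {V : Type} (op : V -> V -> V) (e : V) (l : list R) (g : R -> V) (m : R) :
  (forall x y z, op x (op y z) = op y (op x z)) ->
  NoDup l -> In m l ->
  Iter.iter op e l g = op (g m) (Iter.iter op e (remove Req_dec_T m l) g).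
Proof.
  intros Hop; induction l as [|h l IH]; intros Hnd Hin; [easy|].
  inversion Hnd as [|? ? Hh Hl]; subst; cbn.
  destruct (Req_dec_T m h) as [->|Hne].
  - now rewrite notin_remove.
  - destruct Hin as [->|Hin]; [easy|]. cbn. now rewrite (IH Hl Hin), Hop.
Qed.

Lemma Re_iter (l : list R) (g : R -> C) :
  Re (Iter.iter Cplus (RtoC 0) l g) = Iter.iter Rplus 0 l (fun x => Re (g x)).
Proof. induction l as [|h l IH]; [easy|]. cbn -[Re]. rewrite <- IH. now destruct (g h), (Iter.iter Cplus (RtoC 0) l g). Qed.

Lemma Cmult_iter (l : list R) (g : R -> C) (c : C) :
  (c * Iter.iter Cplus (RtoC 0) l g)%C = Iter.iter Cplus (RtoC 0) l (fun x => c * g x)%C.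
Proof. induction l as [|h l IH]; cbn; [apply Cmult_0_r|]. now rewrite Cmult_plus_distr_l, IH. Qed.

Lemma Cmod_iter_le (l : list R) (g : R -> C) :
  Cmod (Iter.iter Cplus (RtoC 0) l g) <= Iter.iter Rplus 0 l (fun x => Cmod (g x)).
Proof.
  induction l as [|h l IH]; cbn; [rewrite Cmod_0; lra|].
  eapply Rle_trans; [apply Cmod_triangle|]. lra.
Qed.

Lemma iter_Rplus_le (l : list R) (g h : R -> R) :
  (forall x, In x l -> g x <= h x) -> Iter.iter Rplus 0 l g <= Iter.iter Rplus 0 l h.
Proof.
  induction l as [|x l IH]; intros H; cbn; [lra|].
  apply Rplus_le_compat; [apply H; now left | apply IH; intros; apply H; now right].
Qed.

Lemma iter_Rplus_scal (l : list R) (g : R -> R) (c : R) :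
  Iter.iter Rplus 0 l (fun x => c * g x) = c * Iter.iter Rplus 0 l g.
Proof. induction l as [|x l IH]; cbn; [ring|]. rewrite IH; ring. Qed.

Lemma iter_Cplus_app (l l' : list R) (g : R -> C) :
  Iter.iter Cplus (RtoC 0) (l ++ l') g =
  (Iter.iter Cplus (RtoC 0) l g + Iter.iter Cplus (RtoC 0) l' g)%C.
Proof. induction l as [|x l IH]; cbn; [now rewrite Cplus_0_l|]. now rewrite IH, Cplus_assoc. Qed.

Lemma iter_Rplus_filter (l : list R) (p : R -> bool) (g : R -> R) :
  Iter.iter Rplus 0 l g =
  Iter.iter Rplus 0 (filter p l) g + Iter.iter Rplus 0 (filter (fun x => negb (p x)) l) g.
Proof. induction l as [|x l IH]; cbn; [ring|]. destruct (p x); cbn; rewrite IH; ring. Qed.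

(** The nonnegative and the negative terms form two sublists, and on each of them the sum of
    absolute values is a plain sum up to sign. *)
Lemma Rabs_iter_le (l : list R) (g : R -> R) (M : R) :
  (forall l', NoDup l' -> incl l' l -> Rabs (Iter.iter Rplus 0 l' g) <= M) ->
  NoDup l -> Iter.iter Rplus 0 l (fun x => Rabs (g x)) <= 2 * M.
Proof.
  intros H Hnd.
  set (p := fun x => if Rle_dec 0 (g x) then true else false).
  rewrite (iter_Rplus_filter l p).
  assert (Hp : Iter.iter Rplus 0 (filter p l) (fun x => Rabs (g x)) <= M).
  { rewrite (Iter.iter_ext _ _ _ _ g).
    - eapply Rle_trans; [apply Rle_abs|]. apply H; [now apply NoDup_filter|apply incl_filter].
    - intros x Hx; apply filter_In in Hx; destruct Hx as [_ Hx]; unfold p in Hx.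
      destruct (Rle_dec 0 (g x)); [now apply Rabs_pos_eq|discriminate]. }
  assert (Hn : Iter.iter Rplus 0 (filter (fun x => negb (p x)) l) (fun x => Rabs (g x)) <= M).
  { rewrite (Iter.iter_ext _ _ _ _ (fun x => -1 * g x)).
    - rewrite iter_Rplus_scal. eapply Rle_trans; [apply Rle_abs|].
      rewrite Rabs_mult, (Rabs_left (-1)) by lra. replace (- (-1)) with 1 by ring. rewrite Rmult_1_l.
      apply H; [now apply NoDup_filter|apply incl_filter].
    - intros x Hx; apply filter_In in Hx; destruct Hx as [_ Hx]; unfold p in Hx.
      destruct (Rle_dec 0 (g x)); [discriminate|]. rewrite Rabs_left1; lra. }
  lra.
Qed.

(** Real and imaginary parts cost [2 * M] each; the imaginary part enters as the real part of
    [- Ci * g]. *)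
Lemma Cmod_iter_abs_le (l : list R) (g : R -> C) (M : R) :
  (forall l', NoDup l' -> incl l' l -> Cmod (Iter.iter Cplus (RtoC 0) l' g) <= M) ->
  NoDup l -> Iter.iter Rplus 0 l (fun x => Cmod (g x)) <= 4 * M.
Proof.
  intros H Hnd.
  assert (HR : Iter.iter Rplus 0 l (fun x => Rabs (Re (g x))) <= 2 * M).
  { apply Rabs_iter_le; [|easy]. intros l' H1 H2. rewrite <- Re_iter.
    eapply Rle_trans; [apply re_le_Cmod|auto]. }
  assert (HI : Iter.iter Rplus 0 l (fun x => Rabs (Re (- Ci * g x)%C)) <= 2 * M).
  { apply Rabs_iter_le; [|easy]. intros l' H1 H2. rewrite <- Re_iter, <- Cmult_iter.
    eapply Rle_trans; [apply re_le_Cmod|]. rewrite Cmod_mult, Cmod_opp, Cmod_Ci, Rmult_1_l. auto. }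
  enough (Iter.iter Rplus 0 l (fun x => Cmod (g x)) <=
    Iter.iter Rplus 0 l (fun x => Rabs (Re (g x))) + Iter.iter Rplus 0 l (fun x => Rabs (Re (- Ci * g x)%C))) by lra.
  clear. induction l as [|x l IH]; cbn -[Re]; [lra|].
  enough (Cmod (g x) <= Rabs (Re (g x)) + Rabs (Re (- Ci * g x)%C)) by lra.
  destruct (g x) as [a b].
  replace (a, b) with (RtoC a + Ci * RtoC b)%C at 1
    by (unfold RtoC, Ci, Cmult, Cplus; cbn; f_equal; ring).
  eapply Rle_trans; [apply Cmod_triangle|].
  rewrite Cmod_mult, !Cmod_R, Cmod_Ci. cbn.
  apply Req_le. f_equal. rewrite Rmult_1_l. f_equal. ring.
Qed.

(* Unconditional convergence of a complex family is absolute convergence. *)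
Lemma has_sum_abs_tail (S : R -> Prop) (g : R -> C) (s : C) (eps : R) :
  has_sum S g s -> 0 < eps ->
  exists l0, NoDup l0 /\ List.Forall S l0 /\
    forall l, NoDup l -> List.Forall S l -> (forall x, In x l -> ~ In x l0) ->
      Iter.iter Rplus 0 l (fun x => Cmod (g x)) <= eps.
Proof.
  intros H He.
  destruct (H (eps / 8)) as (l0 & Hl0 & Hs); [lra|].
  exists (nodup Req_dec_T l0). split; [apply NoDup_nodup|]. split.
  - apply List.Forall_forall. intros x Hx; apply nodup_In in Hx.
    revert x Hx; now apply List.Forall_forall.
  (* A sum over a list disjoint from [l0] is the difference of two partial sums, each within
     [eps / 8] of [s]; passing to absolute values costs the factor 4. *)
  - intros l Hnd HS Hdisj. replace eps with (4 * (eps / 4)) by lra.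
    apply Cmod_iter_abs_le; [|easy].
    intros l' Hnd' Hi.
    assert (A : forall l2, NoDup l2 -> List.Forall S l2 -> incl l0 l2 ->
      Cmod (Iter.iter Cplus (RtoC 0) l2 g - s)%C < eps / 8) by exact Hs.
    assert (B1 := A (nodup Req_dec_T l0) (NoDup_nodup _ _)).
    assert (B2 := A (l' ++ nodup Req_dec_T l0)).
    assert (F0 : List.Forall S (nodup Req_dec_T l0)).
    { apply List.Forall_forall. intros x Hx; apply nodup_In in Hx.
      revert x Hx; now apply List.Forall_forall. }
    assert (I0 : incl l0 (nodup Req_dec_T l0)) by (intros x Hx; now apply nodup_In).
    specialize (B1 F0 I0).
    assert (Hlt : Cmod (Iter.iter Cplus (RtoC 0) (l' ++ nodup Req_dec_T l0) g - s)%C < eps / 8).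
    { apply B2.
      - apply NoDup_app; auto using NoDup_nodup.
      - apply List.Forall_app; split; [|easy].
        apply List.Forall_forall; intros x Hx. rewrite List.Forall_forall in HS; auto.
      - apply incl_appr, I0. }
    rewrite iter_Cplus_app in Hlt.
    set (A' := Iter.iter Cplus (RtoC 0) l' g) in *.
    set (B' := Iter.iter Cplus (RtoC 0) (nodup Req_dec_T l0) g) in *.
    replace A' with ((A' + B' - s) + - (B' - s))%C by ring.
    eapply Rle_trans; [apply Cmod_triangle|]. rewrite Cmod_opp. lra.
Qed.

Lemma has_sum_abs_bounded (S : R -> Prop) (g : R -> C) (s : C) :
  has_sum S g s -> exists M, 0 < M /\ forall l, NoDup l -> List.Forall S l ->
    Iter.iter Rplus 0 l (fun x => Cmod (g x)) <= M.
Proof.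
  intros H. destruct (has_sum_abs_tail S g s 1 H) as (l0 & Hnd0 & HS0 & Ht); [lra|].
  assert (Hpos : forall l, 0 <= Iter.iter Rplus 0 l (fun x => Cmod (g x))).
  { induction l as [|x l IH]; cbn; [lra|]. pose proof (Cmod_ge_0 (g x)); lra. }
  exists (Iter.iter Rplus 0 l0 (fun x => Cmod (g x)) + 1).
  split; [specialize (Hpos l0); lra|].
  intros l Hnd HS.
  set (p := fun x => if in_dec Req_dec_T x l0 then true else false).
  rewrite (iter_Rplus_filter l p).
  apply Rplus_le_compat.
  - assert (G : forall l1 l2, NoDup l1 -> NoDup l2 -> incl l1 l2 ->
      Iter.iter Rplus 0 l1 (fun x => Cmod (g x)) <= Iter.iter Rplus 0 l2 (fun x => Cmod (g x))).
    { induction l1 as [|x l1 IH]; intros l2 N1 N2 I; cbn; [apply Hpos|].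
      inversion N1; subst.
      rewrite (iter_remove Rplus 0 l2 _ x); [|intros; ring|easy|apply I; now left].
      apply Rplus_le_compat_l, IH; [easy| |].
      + now apply NoDup_remove_Req.
      + intros z Hz. apply in_in_remove; [intros ->; contradiction|]. apply I; now right. }
    apply G; [now apply NoDup_filter|easy|].
    intros x Hx; apply filter_In in Hx; destruct Hx as [_ Hx]; unfold p in Hx.
    now destruct (in_dec Req_dec_T x l0).
  - apply Ht.
    + now apply NoDup_filter.
    + apply List.Forall_forall; intros x Hx; apply filter_In in Hx.
      rewrite List.Forall_forall in HS; apply HS; tauto.
    + intros x Hx; apply filter_In in Hx; destruct Hx as [_ Hx]; unfold p in Hx.
      now destruct (in_dec Req_dec_T x l0).
Qed.

Lemma has_sum_approx (S : R -> Prop) (g : R -> C) (s : C) (l0 : list R) (eps : R) :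
  has_sum S g s -> 0 < eps -> List.Forall S l0 ->
  exists l, NoDup l /\ List.Forall S l /\ incl l0 l /\
    Cmod (Iter.iter Cplus (RtoC 0) l g - s)%C < eps.
Proof.
  intros H He H0. destruct (H eps He) as (l1 & H1 & Hs).
  exists (nodup Req_dec_T (l0 ++ l1)).
  assert (F : List.Forall S (nodup Req_dec_T (l0 ++ l1))).
  { apply List.Forall_forall. intros x Hx; apply nodup_In, in_app_or in Hx.
    rewrite List.Forall_forall in H0, H1; destruct Hx; auto. }
  repeat split; auto using NoDup_nodup.
  - intros x Hx; apply nodup_In, in_or_app; now left.
  - apply Hs; auto using NoDup_nodup. intros x Hx; apply nodup_In, in_or_app; now right.
Qed.

Lemma has_sum_remove (S : R -> Prop) (g : R -> C) (s : C) (m : R) :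
  has_sum S g s -> S m ->
  has_sum S (fun x => if Req_dec_T x m then RtoC 0 else g x) (s - g m)%C.
Proof.
  intros H Hm eps He. destruct (H eps He) as (l0 & H0 & Hs).
  exists (m :: l0). split; [now constructor|].
  intros l Hnd HF Hi.
  assert (Hin : In m l) by (apply Hi; now left).
  assert (Hop : forall x y z : C, (x + (y + z))%C = (y + (x + z))%C) by (intros; ring).
  specialize (Hs l Hnd HF (fun x Hx => Hi x (or_intror Hx))).
  rewrite (iter_remove Cplus _ l g m Hop Hnd Hin) in Hs.
  rewrite (iter_remove Cplus _ l _ m Hop Hnd Hin).
  destruct (Req_dec_T m m) as [_|n]; [|easy].
  rewrite (Iter.iter_ext _ _ _ _ g).
  - match goal with |- Cmod ?a < _ => match type of Hs with Cmod ?b < _ => replace a with b by ring end end. exact Hs.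
  - intros x Hx; apply in_remove in Hx. now destruct (Req_dec_T x m).
Qed.

Lemma iter_Cplus_split (l l2 : list R) :
  NoDup l -> NoDup l2 -> incl l l2 ->
  exists l', NoDup l' /\ incl l' l2 /\ (forall x, In x l' -> ~ In x l) /\
    forall g, Iter.iter Cplus (RtoC 0) l2 g =
      (Iter.iter Cplus (RtoC 0) l g + Iter.iter Cplus (RtoC 0) l' g)%C.
Proof.
  revert l2; induction l as [|x l IH]; intros l2 N1 N2 I.
  - exists l2. repeat split; auto using incl_refl. intros g; cbn; now rewrite Cplus_0_l.
  - inversion N1; subst.
    destruct (IH (remove Req_dec_T x l2)) as (l' & A & B & D & E);
      [easy|now apply NoDup_remove_Req| |].
    { intros z Hz. apply in_in_remove; [intros ->; contradiction|]. apply I; now right. }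
    exists l'. repeat split; [easy| | |].
    + intros z Hz; apply B in Hz; apply in_remove in Hz; tauto.
    + intros z Hz [->|Hz']; [|now apply (D z)].
      apply B, in_remove in Hz; tauto.
    + intros g. rewrite (iter_remove Cplus _ l2 g x).
      * rewrite E; cbn. ring.
      * intros; ring.
      * easy.
      * apply I; now left.
Qed.

(** * Fourier expansions *)

Lemma Cmod_expansion_term (a : R -> C) (m x y : R) :
  Cmod (a m * e2pi (RtoC m * (x, y)))%C = Cmod (a m) * exp (- (2 * PI * m * y)).
Proof. rewrite Cmod_mult, Cmod_e2pi, scal_pair; cbn. f_equal; f_equal; ring. Qed.

(** The moduli of the terms do not depend on [x], so a tail that is small at [x = 0] is small on the
    whole horizontal line. The list contains [m] so that this coefficient can be extracted from the
    finite sum. *)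
Lemma expansion_uniform_approx (u : C) (f : C -> C) (a : R -> C) (y eps m : R) :
  expansion_at_oo u f a -> 0 < y -> 0 < eps -> exponents u m ->
  exists l, NoDup l /\ List.Forall (exponents u) l /\ In m l /\
    forall x, Cmod (f (x, y) - Iter.iter Cplus (RtoC 0) l
      (fun n => a n * e2pi (RtoC n * (x, y))))%C <= eps.
Proof.
  intros Hf Hy He Hm.
  destruct (has_sum_abs_tail _ _ _ (eps / 2) (Hf (0, y) Hy)) as (l0 & N0 & F0 & T0); [lra|].
  exists (nodup Req_dec_T (m :: l0)).
  assert (F : List.Forall (exponents u) (nodup Req_dec_T (m :: l0))).
  { apply List.Forall_forall. intros x Hx; apply nodup_In in Hx.
    rewrite List.Forall_forall in F0. destruct Hx as [<-|Hx]; auto. }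
  split; [apply NoDup_nodup|]. split; [easy|]. split; [apply nodup_In; now left|].
  intros x.
  destruct (has_sum_approx _ _ _ _ (eps / 2) (Hf (x, y) Hy) ltac:(lra) F)
    as (l2 & N2 & F2 & I2 & A2).
  destruct (iter_Cplus_split _ l2 (NoDup_nodup _ _) N2 I2) as (l' & N' & I' & D' & E').
  rewrite E' in A2.
  set (A := Iter.iter Cplus _ (nodup _ _) _) in *.
  set (B := Iter.iter Cplus _ l' _) in *.
  replace (f (x, y) - A)%C with (- (A + B - f (x, y)) + B)%C by ring.
  eapply Rle_trans; [apply Cmod_triangle|]. rewrite Cmod_opp.
  enough (Cmod B <= eps / 2) by lra.
  eapply Rle_trans; [apply Cmod_iter_le|].
  eapply Rle_trans; [|apply (T0 l' N')].
  - apply iter_Rplus_le. intros n _. now rewrite !Cmod_expansion_term; right.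
  - apply List.Forall_forall; intros n Hn. rewrite List.Forall_forall in F2; auto.
  - intros n Hn Hn0. apply (D' n Hn), nodup_In; now right.
Qed.

(** For [n >= - m] the term at height [y] is at most [exp (2 * PI * m * (y - h))] times the term at
    height [h], so absolute convergence at one height controls all greater heights. *)
Lemma expansion_bound (u : C) (f : C -> C) (a : R -> C) (m h : R) :
  expansion_at_oo u f a -> 0 < h ->
  (forall l, exponents u l -> a l <> RtoC 0 -> - m <= l) ->
  exists K, 0 < K /\ forall x y, h <= y -> Cmod (f (x, y)) <= K * exp (2 * PI * m * y).
Proof.
  intros Hf Hh Hm.
  destruct (has_sum_abs_bounded _ _ _ (Hf (0, h) Hh)) as (M & HM & HB).
  exists (M * exp (- (2 * PI * m * h))).
  split; [apply Rmult_lt_0_compat; [easy|apply exp_pos]|].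
  intros x y Hy. rewrite Rmult_assoc, <- exp_plus.
  apply le_epsilon; intros eps He.
  destruct (has_sum_approx _ _ _ nil eps (Hf (x, y) (Rlt_le_trans _ _ _ Hh Hy)) He (List.Forall_nil _))
    as (l & N & F & _ & A).
  set (S := Iter.iter _ _ _ _) in A.
  replace (f (x, y)) with (S + - (S - f (x, y)))%C by ring.
  eapply Rle_trans; [apply Cmod_triangle|]. rewrite Cmod_opp.
  apply Rplus_le_compat; [|lra].
  eapply Rle_trans; [apply Cmod_iter_le|].
  rewrite Rmult_comm.
  eapply Rle_trans; [|apply Rmult_le_compat_l; [left; apply exp_pos|apply (HB l N F)]].
  rewrite <- iter_Rplus_scal. apply iter_Rplus_le.
  intros n Hn. rewrite !Cmod_expansion_term.
  destruct (classic (a n = RtoC 0)) as [->|Ha]; [rewrite Cmod_0; lra|].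
  assert (Hmn : - m <= n) by (apply Hm; [rewrite List.Forall_forall in F; auto|easy]).
  rewrite (Rmult_comm (exp _)), (Rmult_assoc (Cmod _)).
  apply Rmult_le_compat_l; [apply Cmod_ge_0|].
  rewrite <- exp_plus. apply exp_monotone.
  pose proof PI_RGT_0.
  assert (0 <= PI * ((m + n) * (y - h))) by (apply Rmult_le_pos; [lra|apply Rmult_le_pos; lra]).
  nra.
Qed.

Lemma expansion_remove (u : C) (f : C -> C) (a : R -> C) (m : R) :
  expansion_at_oo u f a -> exponents u m ->
  expansion_at_oo u (fun z => f z - a m * e2pi (RtoC m * z))%C
    (fun x => if Req_dec_T x m then RtoC 0 else a x).
Proof.
  intros Hf Hm z Hz.
  intros eps He.
  destruct (has_sum_remove _ _ _ m (Hf z Hz) Hm eps He) as (l0 & H0 & Hs).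
  exists l0; split; [easy|]. intros l N F I. specialize (Hs l N F I).
  erewrite Iter.iter_ext; [exact Hs|].
  intros x _. cbn. destruct (Req_dec_T x m); [apply Cmult_0_l|easy].
Qed.

(** Orthogonality of characters, stated for real parts with arbitrary [c] so that only real
    integrals occur. For [n <> 0] the antiderivative agrees at both ends because
    [sin (n * PI) = 0]. *)
Lemma is_RInt_exponential (c : C) (n : Z) (y : R) :
  is_RInt (fun x => Re (c * e2pi (RtoC (IZR n) * (x, y)))%C) (-1/2) (1/2)
    (if Z.eq_dec n 0 then Re c else 0).
Proof.
  destruct c as [p q].
  destruct (Z.eq_dec n 0) as [->|Hn].
  - apply (is_RInt_ext (fun _ => p)).
    + intros x _. rewrite scal_pair, e2pi_pair, !Rmult_0_l, !Rmult_0_r, Ropp_0, exp_0, cos_0, sin_0.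
      cbn; ring.
    + replace (Re (p, q)) with (scal (1/2 - -1/2) p) by (cbn; unfold mult; cbn; lra).
      apply (@is_RInt_const R_NormedModule).
  - set (N := IZR n). assert (HN : N <> 0) by now apply not_0_IZR.
    pose proof PI_RGT_0 as HP.
    set (F := fun x => exp (- (2 * PI * (N * y))) / (2 * PI * N) *
      (p * sin (2 * PI * (N * x)) + q * cos (2 * PI * (N * x)))).
    set (G := fun x => exp (- (2 * PI * (N * y))) *
      (p * cos (2 * PI * (N * x)) - q * sin (2 * PI * (N * x)))).
    apply (is_RInt_ext G).
    + intros x _. rewrite scal_pair, e2pi_pair. unfold G; cbn. ring.
    + replace 0 with (minus (F (1/2)) (F (-1/2))).
      * apply (is_RInt_derive F G).
        -- intros x _. unfold F, G. auto_derive; [easy|]. field. split; lra.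
        -- intros x _. apply (@ex_derive_continuous R_AbsRing R_NormedModule). unfold G.
           auto_derive. easy.
      * unfold F, minus, plus, opp; cbn.
        replace (2 * PI * (N * (1/2))) with (N * PI) by field.
        replace (2 * PI * (N * (-1/2))) with (- (N * PI)) by field.
        rewrite sin_neg, cos_neg, (sin_eq_0_1 (N * PI)) by (now exists n). ring.
Qed.

Lemma is_RInt_iter (l : list R) (F : R -> R -> R) (v : R -> R) (p q : R) :
  (forall n, In n l -> is_RInt (F n) p q (v n)) ->
  is_RInt (fun x => Iter.iter Rplus 0 l (fun n => F n x)) p q (Iter.iter Rplus 0 l v).
Proof.
  induction l as [|h l IH]; intros H; cbn.
  - pose proof (@is_RInt_const R_NormedModule p q 0) as H0.
    refine (eq_ind _ (is_RInt (fun _ => 0) p q) H0 _ (Rmult_0_r _)).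
  - apply (@is_RInt_plus R_NormedModule); [apply H; now left|].
    apply IH; intros; apply H; now right.
Qed.

(** The multiplier [w] lets a real integral see a complex coefficient; at the saddle point it also
    rotates the main term towards the positive real axis. The integrand is replaced by a uniformly
    close finite sum, of which orthogonality keeps only the term [m]. *)
Lemma coefficient_integral (u : C) (f : C -> C) (a : R -> C) (y m : R) (w : C) :
  expansion_at_oo u f a -> 0 < y -> exponents u m ->
  (forall x : R, continuous (fun x : R => Re (w * (f (x, y) * e2pi (RtoC (- m) * (x, y))))%C) x) ->
  RInt (fun x => Re (w * (f (x, y) * e2pi (RtoC (- m) * (x, y))))%C) (-1/2) (1/2) = Re (w * a m)%C.
Proof.
  intros Hf Hy Hm Hc.
  set (h := fun x => _) in *.
  assert (Hh : is_RInt h (-1/2) (1/2) (RInt h (-1/2) (1/2))).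
  { apply (@RInt_correct R_CompleteNormedModule), ex_RInt_continuous. intros; apply Hc. }
  set (J := RInt _ _ _) in *.
  set (E := exp (2 * PI * m * y)).
  assert (HE : 0 < E) by apply exp_pos.
  pose proof (Cmod_ge_0 w) as Hw.
  apply cond_eq. intros eps He.
  assert (HK : 0 < Cmod w * E + 1) by (pose proof (Rmult_le_pos _ _ Hw (Rlt_le _ _ HE)); lra).
  (* [E] is the modulus of [e2pi (- m z)] on the line; the [+ 1] keeps the denominator positive when
     [w = 0]. *)
  destruct (expansion_uniform_approx u f a y (eps / (2 * (Cmod w * E + 1))) m Hf Hy)
    as (l & N & F & Hin & A).
  { apply Rdiv_lt_0_compat; lra. }
  { easy. }
  set (t := fun n x => Re (w * a n * e2pi (RtoC (n - m) * (x, y)))%C).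
  assert (Ht : is_RInt (fun x => Iter.iter Rplus 0 l (fun n => t n x)) (-1/2) (1/2) (Re (w * a m)%C)).
  { replace (Re (w * a m)%C) with
      (Iter.iter Rplus 0 l (fun n => if Req_dec_T n m then Re (w * a n)%C else 0)).
    - apply is_RInt_iter. intros n Hn.
      destruct (exponents_diff_int u m n Hm) as [k Hk]; [rewrite List.Forall_forall in F; auto|].
      unfold t. rewrite Hk.
      pose proof (is_RInt_exponential (w * a n)%C k y) as HI.
      destruct (Req_dec_T n m) as [->|Hne], (Z.eq_dec k 0) as [->|Hk0]; try exact HI.
      + exfalso; apply Hk0, eq_IZR; lra.
      + exfalso; apply Hne; lra.
    - rewrite (iter_remove Rplus 0 l _ m); [|intros; ring|easy|easy].
      destruct (Req_dec_T m m) as [_|]; [|easy].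
      rewrite (Iter.iter_ext _ _ _ _ (fun x => 0 * 0)), iter_Rplus_scal; [ring|].
      intros x Hx; apply in_remove in Hx. destruct (Req_dec_T x m); [tauto|ring]. }
  pose proof (is_RInt_minus _ _ _ _ _ _ Hh Ht) as HD.
  refine ((fun Hb => _) (norm_RInt_le_const _ (-1/2) (1/2) _ (eps / 2) ltac:(lra) _ HD)).
  - change (Rabs (J + - Re (w * a m)%C) <= (1/2 - -1/2) * (eps / 2)) in Hb.
    unfold Rminus. eapply Rle_lt_trans; [exact Hb|lra].
  - intros x _. change (Rabs (h x + - Iter.iter Rplus 0 l (fun n => t n x)) <= eps / 2).
    replace (h x + - Iter.iter Rplus 0 l (fun n => t n x)) with
      (Re (w * e2pi (RtoC (- m) * (x, y)) * (f (x, y) - Iter.iter Cplus (RtoC 0) l (fun n => a n * e2pi (RtoC n * (x, y)))))%C).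
    + eapply Rle_trans; [apply re_le_Cmod|]. rewrite !Cmod_mult, Cmod_e2pi, scal_pair.
      cbn [Im snd]. replace (- (2 * PI * (- m * y))) with (2 * PI * m * y) by ring. fold E.
      eapply Rle_trans; [apply Rmult_le_compat_l; [|apply A]|].
      * apply Rmult_le_pos; [easy|now left].
      * replace (eps / 2) with ((Cmod w * E + 1) * (eps / (2 * (Cmod w * E + 1)))) by (field; lra).
        apply Rmult_le_compat_r; [|lra]. left; apply Rdiv_lt_0_compat; lra.
    + unfold Cminus. rewrite Cmult_plus_distr_l.
      transitivity (h x - Re (w * e2pi (RtoC (- m) * (x, y)) * Iter.iter Cplus (RtoC 0) l (fun n => a n * e2pi (RtoC n * (x, y))))%C).
      * unfold h; cbv beta. rewrite <- Re_minus. apply (f_equal Re). ring.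
      * unfold Rminus. do 2 f_equal. rewrite Cmult_iter, Re_iter. apply Iter.iter_ext.
        intros n _. unfold t. f_equal.
        replace (RtoC (n - m) * (x, y))%C with (RtoC n * (x, y) + RtoC (- m) * (x, y))%C
          by (unfold RtoC, Cplus, Cmult; cbn; f_equal; ring).
        rewrite e2pi_plus. ring.
Qed.

(** * Holomorphic functions and the automorphy factor *)

(** Here [v] selects the direction and [w] the component: [v] equal to [1] or [Ci] and [w] equal to
    [1] or [- Ci] give all four partial derivatives. *)
Lemma is_derive_along (f : C -> C) (z v w l : C) (t0 : R) :
  @is_derive C_AbsRing C_NormedModule f z l ->
  is_derive (fun t : R => Re (w * f (z + RtoC (t - t0) * v))%C) t0 (Re (w * (v * l))%C).
Proof.
  intros [_ H].
  apply is_derive_Reals. intros eps He.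
  set (K := Cmod w * Cmod v + 1).
  assert (HK : 0 < K).
  { pose proof (Rmult_le_pos _ _ (Cmod_ge_0 w) (Cmod_ge_0 v)). unfold K; lra. }
  assert (HeK : 0 < eps / (2 * K)) by (apply Rdiv_lt_0_compat; lra).
  specialize (H z (fun P HP => HP) (mkposreal _ HeK)).
  destruct H as [d Hd].
  assert (Hv : 0 < Cmod v + 1) by (pose proof (Cmod_ge_0 v); lra).
  assert (Hdv : 0 < d / (Cmod v + 1)) by (apply Rdiv_lt_0_compat; [apply cond_pos|easy]).
  exists (mkposreal _ Hdv). cbn [pos]. intros h Hh0 Hh.
  set (z' := (z + RtoC h * v)%C).
  assert (Hz' : (z' - z)%C = (RtoC h * v)%C) by (unfold z'; ring).
  specialize (Hd z').
  change (Cmod (z' - z)%C < d -> Cmod (f z' - f z - (z' - z) * l)%C <= eps / (2 * K) * Cmod (z' - z)%C) in Hd.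
  rewrite Hz', Cmod_mult, Cmod_R in Hd.
  assert (Hlt : Rabs h * Cmod v < d).
  { apply Rle_lt_trans with (Rabs h * (Cmod v + 1)).
    - apply Rmult_le_compat_l; [apply Rabs_pos|lra].
    - apply (Rmult_lt_compat_r (Cmod v + 1)) in Hh; [|easy].
      replace (d / (Cmod v + 1) * (Cmod v + 1)) with (pos d) in Hh by (field; lra). exact Hh. }
  specialize (Hd Hlt).
  replace (t0 - t0) with 0 by ring. replace (t0 + h - t0) with h by ring.
  fold z'. replace (z + RtoC 0 * v)%C with z by ring.
  replace ((Re (w * f z')%C - Re (w * f z)%C) / h - Re (w * (v * l))%C)
    with (Re (w * (f z' - f z - RtoC h * v * l))%C / h).
  2:{ replace (w * (f z' - f z - RtoC h * v * l))%C
        with ((w * f z') - (w * f z) - RtoC h * (w * (v * l)))%C by ring.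
      rewrite !Re_minus.
      replace (Re (RtoC h * (w * (v * l)))%C) with (h * Re (w * (v * l))%C)
        by (generalize (w * (v * l))%C; intros [p q]; cbn; ring).
      field; easy. }
  unfold Rdiv. rewrite Rabs_mult, Rabs_inv.
  assert (Hhp : 0 < Rabs h) by now apply Rabs_pos_lt.
  apply (Rmult_lt_reg_r (Rabs h)); [easy|].
  rewrite Rmult_assoc, Rinv_l, Rmult_1_r by lra.
  eapply Rle_lt_trans; [apply re_le_Cmod|]. rewrite Cmod_mult.
  eapply Rle_lt_trans; [apply Rmult_le_compat_l; [apply Cmod_ge_0|exact Hd]|].
  replace (Cmod w * (eps / (2 * K) * (Rabs h * Cmod v)))
    with (eps / (2 * K) * (K - 1) * Rabs h) by (unfold K; ring).
  apply Rmult_lt_compat_r; [easy|].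
  replace eps with (eps / (2 * K) * (2 * K)) at 2 by (field; lra).
  apply Rmult_lt_compat_l; [easy|]. lra.
Qed.

Lemma is_derive_ext_eq (f g : R -> R) (x l l' : R) :
  is_derive f x l -> (forall t, f t = g t) -> l = l' -> is_derive g x l'.
Proof. intros Hf Hfg <-. exact (is_derive_ext f g x l Hfg Hf). Qed.

Lemma cauchy_riemann (f : C -> C) (x y : R) :
  holomorphic_on_H f -> 0 < y ->
  exists p q,
    is_derive (fun t : R => Re (f (t, y))) x p /\
    is_derive (fun t : R => Im (f (t, y))) x q /\
    is_derive (fun t : R => Re (f (x, t))) y (- q) /\
    is_derive (fun t : R => Im (f (x, t))) y p.
Proof.
  intros Hf Hy. destruct (Hf (x, y) Hy) as [[p q] Hl].
  exists p, q. split; [|split; [|split]].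
  - refine (is_derive_ext_eq _ _ _ _ _ (is_derive_along f (x, y) (RtoC 1) (RtoC 1) (p, q) x Hl) _ _).
    + intros t. rewrite Cmult_1_l, Cmult_1_r. f_equal. f_equal. unfold Cplus, RtoC; cbn. f_equal; ring.
    + cbn; ring.
  - refine (is_derive_ext_eq _ _ _ _ _ (is_derive_along f (x, y) (RtoC 1) (- Ci)%C (p, q) x Hl) _ _).
    + intros t. rewrite Cmult_1_r.
      replace ((x, y) + RtoC (t - x))%C with ((t, y) : C) by (unfold Cplus, RtoC; cbn; f_equal; ring).
      destruct (f (t, y)); cbn; ring.
    + cbn; ring.
  - refine (is_derive_ext_eq _ _ _ _ _ (is_derive_along f (x, y) Ci (RtoC 1) (p, q) y Hl) _ _).
    + intros t. rewrite Cmult_1_l. f_equal. f_equal. unfold Cplus, Cmult, Ci, RtoC; cbn. f_equal; ring.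
    + cbn; ring.
  - refine (is_derive_ext_eq _ _ _ _ _ (is_derive_along f (x, y) Ci (- Ci)%C (p, q) y Hl) _ _).
    + intros t.
      replace ((x, y) + RtoC (t - y) * Ci)%C with ((x, t) : C)
        by (unfold Cplus, Cmult, Ci, RtoC; cbn; f_equal; ring).
      destruct (f (x, t)); cbn; ring.
    + cbn; ring.
Qed.

Lemma continuous_coefficient_integrand (f : C -> C) (w : C) (y m : R) :
  holomorphic_on_H f -> 0 < y ->
  forall x : R, continuous (fun x : R => Re (w * (f (x, y) * e2pi (RtoC (- m) * (x, y))))%C) x.
Proof.
  intros Hf Hy x.
  destruct (cauchy_riemann f x y Hf Hy) as (p & q & Hp & Hq & _ & _).
  destruct w as [w1 w2].
  set (P := fun t : R => Re (f (t, y))) in *.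
  set (Q := fun t : R => Im (f (t, y))) in *.
  apply (continuous_ext (fun t : R => exp (- (2 * PI * (- m * y))) *
    ((w1 * P t - w2 * Q t) * cos (2 * PI * (- m * t)) - (w1 * Q t + w2 * P t) * sin (2 * PI * (- m * t))))).
  - refine (fun t : R => _). rewrite scal_pair, e2pi_pair. unfold P, Q. destruct (f (t, y)); cbn; ring.
  - apply (@ex_derive_continuous R_AbsRing R_NormedModule).
    assert (ex_derive P x) by (eexists; eassumption).
    assert (ex_derive Q x) by (eexists; eassumption).
    auto_derive. tauto.
Qed.

Lemma constant_of_derive_0 (g : R -> R) (x : R) :
  (forall t, is_derive g t 0) -> g x = g 0.
Proof.
  intros H. destruct (MVT_gen g 0 x (fun _ => 0)) as (c & _ & Hc).
  - intros t _; apply H.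
  - intros t _. apply derivable_continuous_pt. exists 0. apply is_derive_Reals, H.
  - lra.
Qed.

(* The Cauchy-Riemann equations together with |g z| = |z|^k give g' = (k / z) g. *)
Lemma power_modulus_phase (g : C -> C) (k y : R) :
  holomorphic_on_H g -> 0 < y ->
  (forall z, upper_half_plane z -> Cmod (g z) = Rpower (Cmod z) k) ->
  exists c : C, Cmod c = 1 /\
    forall x, g (x, y) = (c * RtoC (Rpower (Cmod (x, y)) k) * Cexp (0, - (k * atan (x / y)))%R)%C.
Proof.
  intros Hg Hy Hmod.
  assert (Hr : forall x t, 0 < t -> 0 < x ^ 2 + t ^ 2) by (intros; nra).
  assert (Hsq : forall x t, 0 < t ->
    Re (g (x, t)) ^ 2 + Im (g (x, t)) ^ 2 = exp (k * ln (x ^ 2 + t ^ 2))).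
  { intros x t Ht. rewrite <- Cmod2_alt, (Hmod (x, t) Ht).
    unfold Rpower. cbn -[Cmod ln]. rewrite Rmult_1_r, <- exp_plus. f_equal.
    replace (x * (x * 1) + t * (t * 1)) with (Cmod (x, t) * Cmod (x, t)).
    - rewrite ln_mult; [ring| |]; apply Cmod_gt_0; intros E; injection E; lra.
    - unfold Cmod; cbn. rewrite sqrt_sqrt; nra. }
  set (P := fun x : R => Re (g (x, y))).
  set (Q := fun x : R => Im (g (x, y))).
  assert (HD : forall x, is_derive P x (k * (x * P x + y * Q x) / (x ^ 2 + y ^ 2)) /\
                    is_derive Q x (k * (x * Q x - y * P x) / (x ^ 2 + y ^ 2))).
  { intros x. destruct (cauchy_riemann g x y Hg Hy) as (p & q & H1 & H2 & H3 & H4).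
    fold P in H1; fold Q in H2.
    pose proof (Hr x y Hy) as Hxy.
    set (r := x ^ 2 + y ^ 2) in *.
    assert (E : P x ^ 2 + Q x ^ 2 = exp (k * ln r)) by (apply Hsq, Hy).
    assert (Epos : 0 < P x ^ 2 + Q x ^ 2) by (rewrite E; apply exp_pos).
    (* [Ex] and [Ey] are half the derivatives of [|g|^2 = |z|^(2k)] in the two coordinates, both
       written in [p] and [q] by the Cauchy-Riemann equations. This linear system has determinant
       [- |g|^2], which does not vanish. *)
    assert (Ex : P x * p + Q x * q = (P x ^ 2 + Q x ^ 2) * (k * x / r)).
    { assert (D1 : is_derive (fun t => P t ^ 2 + Q t ^ 2) x (2 * (P x * p + Q x * q))).
      { auto_derive.
        - split; [now exists p|]. split; [now exists q|easy].
        - rewrite (is_derive_unique (fun t : R => P t) _ _ H1), (is_derive_unique (fun t : R => Q t) _ _ H2). ring. }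
      assert (D2 : is_derive (fun t => P t ^ 2 + Q t ^ 2) x (2 * ((P x ^ 2 + Q x ^ 2) * (k * x / r)))).
      { apply (is_derive_ext (fun t => exp (k * ln (t ^ 2 + y ^ 2)))).
        - intros t. symmetry. apply (Hsq t y Hy).
        - rewrite E. auto_derive; [now apply Hr|]. replace (x * (x * 1) + y * (y * 1)) with r by (unfold r; ring). field. lra. }
      apply is_derive_unique in D1. apply is_derive_unique in D2. lra. }
    set (U := fun t : R => Re (g (x, t))) in *. set (V := fun t : R => Im (g (x, t))) in *.
    assert (Ey : Q x * p - P x * q = (P x ^ 2 + Q x ^ 2) * (k * y / r)).
    { assert (D1 : is_derive (fun t => U t ^ 2 + V t ^ 2) y (2 * (Q x * p - P x * q))).
      { auto_derive.
        - split; [now exists (- q)|]. split; [now exists p|easy].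
        - rewrite (is_derive_unique (fun t : R => U t) _ _ H3), (is_derive_unique (fun t : R => V t) _ _ H4). change (U y) with (P x). change (V y) with (Q x). ring. }
      assert (D2 : is_derive (fun t => U t ^ 2 + V t ^ 2) y (2 * ((P x ^ 2 + Q x ^ 2) * (k * y / r)))).
      { apply (is_derive_ext_loc (fun t => exp (k * ln (x ^ 2 + t ^ 2)))).
        - exists (mkposreal y Hy). intros t Ht. symmetry. apply Hsq.
          unfold ball in Ht; cbn in Ht. unfold AbsRing_ball, abs, minus, plus, opp in Ht; cbn in Ht.
          apply Rabs_def2 in Ht; lra.
        - rewrite E. auto_derive; [now apply Hr|]. replace (x * (x * 1) + y * (y * 1)) with r by (unfold r; ring). field. lra. }
      apply is_derive_unique in D1. apply is_derive_unique in D2. lra. }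
    assert (p = k * (x * P x + y * Q x) / r).
    { apply (Rmult_eq_reg_l (P x ^ 2 + Q x ^ 2)); [|lra].
      transitivity (P x * (P x * p + Q x * q) + Q x * (Q x * p - P x * q)); [ring|].
      rewrite Ex, Ey. field. lra. }
    assert (q = k * (x * Q x - y * P x) / r).
    { apply (Rmult_eq_reg_l (P x ^ 2 + Q x ^ 2)); [|lra].
      transitivity (Q x * (P x * p + Q x * q) - P x * (Q x * p - P x * q)); [ring|].
      rewrite Ex, Ey. field. lra. }
    subst p q. split; assumption. }
  (* As [arg z = PI / 2 - atan (x / y)], the number [A + i B] is [g / z^k] up to the constant
     [e^(i PI k / 2)]; hence its derivative along the line vanishes. *)
  set (rho := fun x : R => exp (- (k / 2) * ln (x ^ 2 + y ^ 2))).
  set (A := fun x : R => rho x * (P x * cos (k * atan (x / y)) - Q x * sin (k * atan (x / y)))).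
  set (B := fun x : R => rho x * (P x * sin (k * atan (x / y)) + Q x * cos (k * atan (x / y)))).
  assert (HA : forall x, A x = A 0).
  { intros x. apply constant_of_derive_0. intros t. destruct (HD t) as [H1 H2]. unfold A, rho.
    auto_derive.
    - pose proof (Hr t y Hy). repeat split; try easy; eexists; eassumption.
    - rewrite (is_derive_unique (fun t : R => P t) _ _ H1), (is_derive_unique (fun t : R => Q t) _ _ H2).
      pose proof (Hr t y Hy). field. unfold Rsqr. repeat split; try nra. }
  assert (HB : forall x, B x = B 0).
  { intros x. apply constant_of_derive_0. intros t. destruct (HD t) as [H1 H2]. unfold B, rho.
    auto_derive.
    - pose proof (Hr t y Hy). repeat split; try easy; eexists; eassumption.
    - rewrite (is_derive_unique (fun t : R => P t) _ _ H1), (is_derive_unique (fun t : R => Q t) _ _ H2).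
      pose proof (Hr t y Hy). field. repeat split; try nra. }
  assert (Hrho : forall x, Rpower (Cmod (x, y)) k * rho x = 1).
  { intros x. unfold Rpower, rho. rewrite <- exp_plus, <- exp_0. f_equal.
    replace (ln (x ^ 2 + y ^ 2)) with (2 * ln (Cmod (x, y))); [field|].
    replace (x ^ 2 + y ^ 2) with (Cmod (x, y) * Cmod (x, y)).
    - rewrite ln_mult; [ring| |]; apply Cmod_gt_0; intros E; injection E; lra.
    - unfold Cmod; cbn. rewrite sqrt_sqrt; nra. }
  assert (HPQ : forall x, g (x, y) = ((A 0, B 0) * RtoC (Rpower (Cmod (x, y)) k) * Cexp (0, - (k * atan (x / y)))%R)%C).
  { intros x. rewrite <- (HA x), <- (HB x).
    specialize (Hrho x). unfold Cexp; cbn [Re Im fst snd]. rewrite exp_0, cos_neg, sin_neg.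
    pose proof (sin2_cos2 (k * atan (x / y))) as Hsc. unfold Rsqr in Hsc.
    rewrite (surjective_pairing (g (x, y))). change (fst (g (x, y))) with (P x). change (snd (g (x, y))) with (Q x).
    unfold A, B. set (s := sin _) in *. set (c := cos _) in *. set (rp := Rpower _ _) in *.
    unfold Cmult, RtoC; cbn. f_equal.
    - transitivity (rp * rho x * (P x * (s * s + c * c))); [rewrite Hrho, Hsc; ring|ring].
    - transitivity (rp * rho x * (Q x * (s * s + c * c))); [rewrite Hrho, Hsc; ring|ring]. }
  exists (A 0, B 0). split; [|exact HPQ].
  pose proof (f_equal Cmod (HPQ 0)) as H0.
  rewrite !Cmod_mult, Cmod_R, Cmod_Cexp, (Hmod (0, y) Hy) in H0. cbn [Re fst] in H0. rewrite exp_0, Rmult_1_r in H0.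
  assert (Hp : 0 < Rpower (Cmod (0, y)) k) by apply exp_pos.
  rewrite (Rabs_pos_eq (Rpower _ _)) in H0 by lra.
  apply (Rmult_eq_reg_r (Rpower (Cmod (0, y)) k)); lra.
Qed.

(** * Reduction to the region Im z >= 1/2 *)

(** This is [|c z + d|^2]. The image of [z] has height [y / denom_sq g x y], so
    [denom_sq g x y <= 2 * y] says that this height is at least 1/2. *)
Definition denom_sq (g : SL2Z) (x y : R) : R :=
  (IZR (mc g) * x + IZR (md g)) ^ 2 + (IZR (mc g) * y) ^ 2.

(* While [y < 1/2], translating to [|x| <= 1/2] and inverting at least doubles [y]. *)
Lemma sl2z_reduction (n : nat) : forall x y : R, 0 < y -> 1 <= 2 ^ n * (2 * y) ->
  exists g : SL2Z, denom_sq g x y <= 2 * y.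
Proof.
  unfold denom_sq.
  induction n as [|n IH]; intros x y Hy Hn.
  - exists (mkSL2Z 1 0 0 1 eq_refl). cbn in *. lra.
  - destruct (Rle_lt_dec (1 / 2) y) as [Hy2|Hy2].
    { exists (mkSL2Z 1 0 0 1 eq_refl). cbn. lra. }
    destruct (archimed (x - 1 / 2)) as [Hm1 Hm2].
    set (m := up (x - 1 / 2)) in *.
    set (x' := x - IZR m).
    set (r := x' ^ 2 + y ^ 2).
    assert (Hx' : - (1/2) <= x' <= 1/2) by (unfold x'; lra).
    assert (Hr : 0 < r) by (unfold r; nra).
    assert (Hr2 : r <= 1 / 2) by (unfold r; nra).
    destruct (IH (- x' / r) (y / r)) as [g Hg].
    + now apply Rdiv_lt_0_compat.
    + assert (2 * y <= y / r).
      { apply (Rmult_le_reg_r r); [easy|]. unfold Rdiv. rewrite Rmult_assoc, (Rmult_assoc y), Rinv_l by lra.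
        nra. }
      assert (0 < 2 ^ n) by (apply pow_lt; lra).
      cbn in Hn. apply Rle_trans with (1 := Hn). nra.
    + destruct g as [a b c d Hdet]. cbn [mc md] in Hg.
      assert (Hdet' : (b * (- c - d * m) - (- a - b * m) * d = 1)%Z) by lia.
      (* The product [g S T^(-m)], since the induction hypothesis was applied at [-1 / (z - m)]. *)
      exists (mkSL2Z b (- a - b * m) d (- c - d * m) Hdet'). cbn [mc md].
      rewrite minus_IZR, opp_IZR, mult_IZR.
      replace (IZR d * x + (- IZR c - IZR d * IZR m)) with (IZR d * x' - IZR c) by (unfold x'; ring).
      assert (E : (IZR c * (- x' / r) + IZR d) ^ 2 + (IZR c * (y / r)) ^ 2 =
        ((IZR d * x' - IZR c) ^ 2 + (IZR d * y) ^ 2) / r).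
      { transitivity ((IZR c ^ 2 * r - 2 * IZR c * IZR d * x' * r + IZR d ^ 2 * r ^ 2) / r ^ 2).
        - unfold r. field. fold r. lra.
        - apply (Rmult_eq_reg_r (r ^ 2)); [|apply Rgt_not_eq, pow_lt, Hr].
          transitivity ((IZR c ^ 2 - 2 * IZR c * IZR d * x' + IZR d ^ 2 * r) * r); [field; lra|].
          transitivity (((IZR d * x' - IZR c) ^ 2 + (IZR d * y) ^ 2) * r); [unfold r; ring|field; lra]. }
      rewrite E in Hg. unfold Rdiv in Hg. rewrite <- Rmult_assoc in Hg.
      apply (Rmult_le_reg_r (/ r)); [now apply Rinv_0_lt_compat|exact Hg].
Qed.

Lemma exists_pow2_ge (M : R) : exists n : nat, M <= 2 ^ n.
Proof.
  destruct (Pow_x_infinity 2) with (b := M) as [N HN].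
  - rewrite Rabs_pos_eq; lra.
  - exists N. specialize (HN N (Nat.le_refl N)).
    rewrite Rabs_pos_eq in HN; [lra|]. apply pow_le; lra.
Qed.

Lemma exists_reduced (x y : R) : 0 < y -> exists g : SL2Z, denom_sq g x y <= 2 * y.
Proof.
  intros Hy. destruct (exists_pow2_ge (/ (2 * y))) as [n Hn].
  apply (sl2z_reduction n x y Hy).
  apply (Rmult_le_compat_r (2 * y)) in Hn; [|lra].
  rewrite Rinv_l in Hn; lra.
Qed.

Lemma denom_sq_pos (g : SL2Z) (x y : R) : 0 < y -> 0 < denom_sq g x y.
Proof.
  intros Hy. unfold denom_sq. destruct g as [a b c d Hdet]; cbn [mc md].
  destruct (Z.eq_dec c 0) as [->|Hc].
  - assert (Hd : d <> 0%Z) by (intros ->; lia).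
    apply not_0_IZR in Hd. rewrite !Rmult_0_l. pose proof (pow2_gt_0 _ Hd). lra.
  - apply not_0_IZR in Hc. assert (IZR c * y <> 0) by (apply Rmult_integral_contrapositive; lra).
    pose proof (pow2_gt_0 _ H). pose proof (pow2_ge_0 (IZR c * x + IZR d)). lra.
Qed.

Lemma denom_pair (g : SL2Z) (x y : R) :
  denom g (x, y) = (IZR (mc g) * x + IZR (md g), IZR (mc g) * y).
Proof. unfold denom, RtoC, Cmult, Cplus; cbn. f_equal; ring. Qed.

Lemma Cmod_denom (g : SL2Z) (x y : R) : Cmod (denom g (x, y)) = sqrt (denom_sq g x y).
Proof. now rewrite denom_pair. Qed.

Lemma mobius_pair (g : SL2Z) (x y : R) : 0 < y ->
  exists t, mobius g (x, y) = (t, y / denom_sq g x y).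
Proof.
  intros Hy. pose proof (denom_sq_pos g x y Hy) as HD.
  eexists. unfold mobius. rewrite denom_pair. unfold Cdiv, Cinv, Cmult, Cplus, RtoC; cbn [fst snd].
  f_equal.
  change ((IZR (mc g) * x + IZR (md g)) ^ 2 + (IZR (mc g) * y) ^ 2) with (denom_sq g x y).
  assert (Hdet : IZR (ma g) * IZR (md g) - IZR (mb g) * IZR (mc g) = 1).
  { rewrite <- !mult_IZR, <- minus_IZR. now rewrite (det_eq_1 g). }
  rewrite <- (Rmult_1_l (y / _)), <- Hdet.
  unfold Rdiv; field. lra.
Qed.

(** * Bounds for f and its coefficients; the least exponent *)

Lemma modular_transform_Cmod (k : R) (j : SL2Z -> C -> C) (f : C -> C) (g : SL2Z) (x y : R) :
  modular_function k j f -> 0 < y ->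
  exists t, Cmod (f (x, y)) = Rpower (sqrt (denom_sq g x y)) (- k) * Cmod (f (t, y / denom_sq g x y)).
Proof.
  intros Hf Hy. destruct (mobius_pair g x y Hy) as [t Ht].
  exists t. rewrite <- Ht, (mf_transform _ _ _ Hf g (x, y) Hy), Cmod_mult,
    (mf_factor_modulus _ _ _ Hf g (x, y) Hy), Cmod_denom, <- Rmult_assoc, <- Rpower_plus.
  rewrite Rplus_opp_l, Rpower_O; [ring|]. apply sqrt_lt_R0, denom_sq_pos, Hy.
Qed.

(** A reducing [g] moves the point to height at least 1/2, where [expansion_bound] applies. Because
    [k < 0], the factor [|c z + d|^(-k)] increases with [|c z + d| <= sqrt (2 * y)]. The matrix [g]
    stays in the conclusion because its height decides how large the exponential can be. *)
Lemma modular_bound (k m : R) (j : SL2Z -> C -> C) (f : C -> C) (a : R -> C) :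
  k < 0 -> modular_function k j f ->
  expansion_at_oo (translation_constant j) f a ->
  (forall l, exponents (translation_constant j) l -> a l <> RtoC 0 -> - m <= l) ->
  exists K, 0 < K /\ forall x y, 0 < y -> exists g,
    denom_sq g x y <= 2 * y /\
    Cmod (f (x, y)) <= K * Rpower (sqrt (2 * y)) (- k) * exp (2 * PI * m * (y / denom_sq g x y)).
Proof.
  intros Hk Hf Hexp Hm.
  destruct (expansion_bound _ f a m (1/2) Hexp ltac:(lra) Hm) as (K & HK & HB).
  exists K; split; [easy|]. intros x y Hy.
  destruct (exists_reduced x y Hy) as [g Hg]. exists g; split; [easy|].
  pose proof (denom_sq_pos g x y Hy) as HD.
  destruct (modular_transform_Cmod k j f g x y Hf Hy) as [t ->].
  assert (HY : 1 / 2 <= y / denom_sq g x y).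
  { apply (Rmult_le_reg_r (denom_sq g x y)); [easy|].
    unfold Rdiv. rewrite (Rmult_assoc y), Rinv_l; lra. }
  rewrite (Rmult_comm K), Rmult_assoc.
  apply Rmult_le_compat.
  - left; apply exp_pos.
  - apply Cmod_ge_0.
  - apply Rle_Rpower_l; [lra|]. split; [now apply sqrt_lt_R0|now apply sqrt_le_1_alt].
  - apply HB, HY.
Qed.

(** Cauchy's estimate: with the multiplier [Cconj (a l)] the integral equals [|a l|^2], and one
    factor [|a l|] cancels. *)
Lemma coefficient_bound (u : C) (f : C -> C) (a : R -> C) (y l M : R) :
  holomorphic_on_H f -> expansion_at_oo u f a -> 0 < y -> exponents u l ->
  (forall x, Cmod (f (x, y)) <= M) ->
  Cmod (a l) <= M * exp (2 * PI * l * y).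
Proof.
  intros Hh Hf Hy Hl HM.
  assert (HM0 : 0 <= M) by (eapply Rle_trans; [apply Cmod_ge_0|apply (HM 0)]).
  pose proof (exp_pos (2 * PI * l * y)) as HE.
  destruct (Rle_lt_dec (Cmod (a l)) 0) as [H0|H0].
  { apply Rle_trans with (1 := H0). apply Rmult_le_pos; lra. }
  pose proof (continuous_coefficient_integrand f (Cconj (a l)) y l Hh Hy) as Hc.
  pose proof (coefficient_integral u f a y l (Cconj (a l)) Hf Hy Hl Hc) as HI.
  assert (Hi : is_RInt (fun x : R => Re (Cconj (a l) * (f (x, y) * e2pi (RtoC (- l) * (x, y))))%C) (-1/2) (1/2)
     (Re (Cconj (a l) * a l)%C)).
  { rewrite <- HI. apply (@RInt_correct R_CompleteNormedModule), ex_RInt_continuous. intros; apply Hc. }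
  apply (norm_RInt_le_const _ (-1/2) (1/2) _ (Cmod (a l) * (M * exp (2 * PI * l * y)))) in Hi.
  - change (Rabs (Re (Cconj (a l) * a l)%C) <= (1/2 - -1/2) * (Cmod (a l) * (M * exp (2 * PI * l * y)))) in Hi.
    rewrite Cmult_comm, <- Cmod2_conj in Hi. cbn [Re RtoC fst] in Hi.
    rewrite Rabs_pos_eq in Hi by apply pow2_ge_0.
    apply (Rmult_le_reg_l (Cmod (a l))); [easy|]. nra.
  - lra.
  - intros x _.
    change (Rabs (Re (Cconj (a l) * (f (x, y) * e2pi (RtoC (- l) * (x, y))))%C) <= Cmod (a l) * (M * exp (2 * PI * l * y))).
    eapply Rle_trans; [apply re_le_Cmod|].
    rewrite !Cmod_mult, Cmod_conj, Cmod_e2pi, scal_pair. cbn [Im snd].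
    replace (- (2 * PI * (- l * y))) with (2 * PI * l * y) by ring.
    apply Rmult_le_compat_l; [lra|]. apply Rmult_le_compat_r; [lra|apply HM].
Qed.

Lemma exists_negative_exponent (k : R) (j : SL2Z -> C -> C) (f : C -> C) (a : R -> C) :
  k < 0 -> modular_function k j f ->
  (exists z : C, upper_half_plane z /\ f z <> RtoC 0) ->
  expansion_at_oo (translation_constant j) f a ->
  exists l, exponents (translation_constant j) l /\ l < 0 /\ a l <> RtoC 0.
Proof.
  intros Hk Hf (z & Hz & Hfz) Hexp.
  apply NNPP; intros Hno. apply Hfz; clear Hfz.
  assert (Hm : forall l, exponents (translation_constant j) l -> a l <> RtoC 0 -> - 0 <= l).
  { intros l Hl Ha. apply Rnot_lt_le; intros Hlt. apply Hno. exists l. repeat split; [easy|lra|easy]. }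
  destruct (modular_bound k 0 j f a Hk Hf Hexp Hm) as (K & HK & HB).
  assert (Ha : forall l, exponents (translation_constant j) l -> a l = RtoC 0).
  { intros l Hl. apply NNPP; intros Hne. apply Cmod_gt_0 in Hne.
    set (Cst := K * exp (PI * Rabs l)).
    assert (HC : 0 < Cst) by (apply Rmult_lt_0_compat; [easy|apply exp_pos]).
    (* With [2 * y = exp (- (2 * t))] the weight factor is [exp (k * t)], and [t] is large enough to
       push it below [Cmod (a l) / Cst]. *)
    set (t := Rabs (ln (Cmod (a l) / Cst) / k) + 1).
    assert (Ht : 0 < t) by (pose proof (Rabs_pos (ln (Cmod (a l) / Cst) / k)); unfold t; lra).
    set (y := exp (- (2 * t)) / 2).
    assert (Hy : 0 < y) by (pose proof (exp_pos (- (2 * t))); unfold y; lra).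
    assert (Hy2 : y <= 1 / 2).
    { unfold y. assert (exp (- (2 * t)) <= exp 0) by (apply exp_monotone; lra). rewrite exp_0 in *. lra. }
    assert (Hs : sqrt (2 * y) = exp (- t)).
    { replace (2 * y) with (Rsqr (exp (- t))).
      - apply sqrt_Rsqr. left; apply exp_pos.
      - unfold Rsqr, y. rewrite <- exp_plus. replace (- t + - t) with (- (2 * t)) by ring. field. }
    assert (Hb : Cmod (a l) <= K * exp (k * t) * exp (2 * PI * l * y)).
    { apply (coefficient_bound _ f a y l _ (mf_holomorphic _ _ _ Hf) Hexp Hy Hl).
      intros x. destruct (HB x y Hy) as (g & _ & Hg).
      rewrite Hs in Hg. unfold Rpower in Hg. rewrite ln_exp, Rmult_0_r, Rmult_0_l, exp_0, Rmult_1_r in Hg.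
      replace (- k * - t) with (k * t) in Hg by ring. exact Hg. }
    assert (He : exp (2 * PI * l * y) <= exp (PI * Rabs l)).
    { apply exp_monotone. pose proof PI_RGT_0. pose proof (Rle_abs l). pose proof (Rabs_pos l).
      apply Rle_trans with (2 * PI * Rabs l * y).
      - apply Rmult_le_compat_r; [lra|]. apply Rmult_le_compat_l; lra.
      - assert (0 <= PI * Rabs l) by (apply Rmult_le_pos; lra). nra. }
    assert (Hkt : k * t < ln (Cmod (a l) / Cst)).
    { unfold t. set (q := ln _ / k). replace (ln (Cmod (a l) / Cst)) with (k * q) by (unfold q; field; lra).
      pose proof (Rle_abs q). nra. }
    apply exp_increasing in Hkt. rewrite exp_ln in Hkt by now apply Rdiv_lt_0_compat.
    apply (Rmult_lt_compat_l Cst) in Hkt; [|easy].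
    replace (Cst * (Cmod (a l) / Cst)) with (Cmod (a l)) in Hkt by (field; lra).
    assert (K * exp (k * t) * exp (2 * PI * l * y) <= Cst * exp (k * t)).
    { unfold Cst. pose proof (exp_pos (k * t)).
      replace (K * exp (PI * Rabs l) * exp (k * t)) with (K * exp (k * t) * exp (PI * Rabs l)) by ring.
      apply Rmult_le_compat_l; [|easy]. apply Rmult_le_pos; lra. }
    lra. }
  apply Cmod_eq_0, Rle_antisym; [|apply Cmod_ge_0].
  apply le_epsilon; intros eps He. rewrite Rplus_0_l.
  destruct (has_sum_approx _ _ _ nil eps (Hexp z Hz) He (List.Forall_nil _)) as (l & _ & F & _ & A).
  rewrite (Iter.iter_ext _ _ _ _ (fun x => RtoC 0 * RtoC 0)%C), <- Cmult_iter, Cmult_0_l in A.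
  - replace (RtoC 0 - f z)%C with (- f z)%C in A by ring. rewrite Cmod_opp in A. lra.
  - intros x Hx. rewrite List.Forall_forall in F. rewrite (Ha x (F x Hx)). ring.
Qed.

(** The finite order condition supplies its own coefficient family; uniqueness carries its
    finiteness over to the given one. *)
Lemma coefficient_unique (u : C) (f : C -> C) (a b : R -> C) (l : R) :
  holomorphic_on_H f -> expansion_at_oo u f a -> expansion_at_oo u f b -> exponents u l -> a l = b l.
Proof.
  intros Hh Ha Hb Hl.
  assert (E : forall w, Re (w * a l)%C = Re (w * b l)%C).
  { intros w. rewrite <- (coefficient_integral u f a 1 l w), <- (coefficient_integral u f b 1 l w);
      auto using Rlt_0_1, continuous_coefficient_integrand. }
  pose proof (E (RtoC 1)) as E1. pose proof (E Ci) as E2.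
  destruct (a l), (b l). cbn in E1, E2. f_equal; lra.
Qed.

Lemma exists_least_in_list (P : R -> Prop) (L : list R) :
  (exists x, In x L /\ P x) -> exists x, In x L /\ P x /\ forall y, In y L -> P y -> x <= y.
Proof.
  induction L as [|h L IH]; intros (x & Hx & HP); [easy|].
  destruct (classic (exists x, In x L /\ P x)) as [H|H].
  - destruct (IH H) as (m & Hm & HPm & Hmin).
    destruct (classic (P h /\ h <= m)) as [[Hh Hhm]|Hh].
    + exists h. repeat split; [now left|easy|].
      intros y [<-|Hy] HPy; [lra|]. apply Rle_trans with (1 := Hhm); auto.
    + exists m. repeat split; [now right|easy|].
      intros y [<-|Hy] HPy; [|auto]. apply Rnot_lt_le; intros Hlt. apply Hh; split; [easy|lra].
  - exists x. repeat split; [easy|easy|]. intros y [<-|Hy] HPy.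
    + destruct Hx as [->|Hx]; [lra|]. exfalso; apply H; now exists x.
    + exfalso; apply H; now exists y.
Qed.

(** * The saddle point *)

(** The period has length 1, so the uniform loss [B] is subtracted exactly once. *)
Lemma RInt_ge_bump (h : R -> R) (b B d : R) :
  (forall x, continuous h x) -> 0 < d < 1 / 2 ->
  (forall x, - (1 / 2) <= x <= 1 / 2 -> - B <= h x) ->
  (forall x, Rabs x <= d -> b - B <= h x) ->
  2 * d * b - B <= RInt h (-1/2) (1/2).
Proof.
  intros Hc Hd H1 H2.
  assert (He : forall p q, ex_RInt h p q) by (intros; apply (@ex_RInt_continuous R_CompleteNormedModule); intros; apply Hc).
  assert (G : forall p q v, p <= q -> (forall x, p < x < q -> v <= h x) -> v * (q - p) <= RInt h p q).
  { intros p q v Hpq Hv. replace (v * (q - p)) with (RInt (fun _ => v) p q).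
    - apply RInt_le; auto. apply (@ex_RInt_const R_NormedModule).
    - rewrite RInt_const. unfold scal; cbn; unfold mult; cbn; ring. }
  rewrite <- (RInt_Chasles h (-1/2) (-d) (1/2)) by auto.
  rewrite <- (RInt_Chasles h (-d) d (1/2)) by auto.
  change (2 * d * b - B <= RInt h (-1/2) (-d) + (RInt h (-d) d + RInt h d (1/2))).
  pose proof (G (-1/2) (-d) (- B) ltac:(lra) ltac:(intros; apply H1; lra)).
  pose proof (G (-d) d (b - B) ltac:(lra) ltac:(intros; apply H2, Rabs_le; lra)).
  pose proof (G d (1/2) (- B) ltac:(lra) ltac:(intros; apply H1; lra)).
  lra.
Qed.

Lemma exp_neg_inv_lt_pow (A kap : R) (n : nat) : 0 < A -> 0 < kap ->
  exists s0, 0 < s0 /\ forall s, 0 < s < s0 -> A * exp (- (kap / s)) < s ^ n.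
Proof.
  intros HA Hk.
  set (F := INR (fact (S n))).
  assert (HF : 0 < F) by apply INR_fact_lt_0.
  assert (Hkn : 0 < kap ^ S n) by now apply pow_lt.
  exists (kap ^ S n / (A * F)). split.
  { apply Rdiv_lt_0_compat; [easy|]. now apply Rmult_lt_0_compat. }
  intros s [Hs Hs0].
  assert (Hx : 0 < kap / s) by now apply Rdiv_lt_0_compat.
  (* The Taylor term of order [n + 1] suffices: besides [s ^ n] it leaves a factor [/ s], which
     outgrows all constants. *)
  assert (HT : (kap / s) ^ S n / F <= exp (kap / s)).
  { eapply Rle_trans; [|apply (exp_ge_taylor _ (S n)); lra].
    rewrite tech5. fold F.
    assert (0 <= sum_f_R0 (fun i => (kap / s) ^ i / INR (fact i)) n); [|lra].
    apply cond_pos_sum. intros i. apply Rlt_le, Rdiv_lt_0_compat; [now apply pow_lt|apply INR_fact_lt_0]. }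
  rewrite exp_Ropp.
  assert (Hsn : 0 < s ^ n) by now apply pow_lt.
  apply (Rmult_lt_reg_r (exp (kap / s))); [apply exp_pos|].
  rewrite Rmult_assoc, Rinv_l, Rmult_1_r by apply Rgt_not_eq, exp_pos.
  eapply Rlt_le_trans; [|apply Rmult_le_compat_l; [left; exact Hsn|exact HT]].
  replace (s ^ n * ((kap / s) ^ S n / F)) with (kap ^ S n / F / s).
  - apply (Rmult_lt_reg_r s); [easy|].
    replace (kap ^ S n / F / s * s) with (A * (kap ^ S n / (A * F))) by (field; lra).
    now apply Rmult_lt_compat_l.
  - unfold Rdiv. rewrite Rpow_mult_distr. cbn [pow]. rewrite pow_inv. field. repeat split; lra.
Qed.

Lemma Rabs_atan_le (t : R) : Rabs (atan t) <= Rabs t.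
Proof.
  destruct (MVT_gen atan 0 t (fun x => / (1 + x ^ 2))) as (c & _ & Hc).
  - intros x _. auto_derive; [easy|]. unfold Rsqr. field. nra.
  - intros x _. apply derivable_continuous_pt, derivable_pt_atan.
  - rewrite atan_0, !Rminus_0_r in Hc. rewrite Hc, Rabs_mult.
    assert (0 < 1 + c ^ 2) by nra.
    rewrite Rabs_pos_eq by (left; now apply Rinv_0_lt_compat).
    rewrite <- (Rmult_1_l (Rabs t)) at 2. apply Rmult_le_compat_r; [apply Rabs_pos|].
    rewrite <- Rinv_1. apply Rinv_le_contravar; nra.
Qed.

Lemma cos_ge_half (t : R) : Rabs t <= 1 -> 1 / 2 <= cos t.
Proof.
  intros Ht. rewrite <- cos_PI3.
  assert (cos t = cos (Rabs t)) as ->.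
  { unfold Rabs; destruct (Rcase_abs t); [now rewrite cos_neg|easy]. }
  pose proof PI2_3_2. pose proof (Rabs_pos t).
  apply cos_decr_1; lra.
Qed.

Definition S_mat : SL2Z := mkSL2Z 0 (-1) 1 0 eq_refl.

(** The transformation law under [z |-> -1 / z], solved for [f z]. The constant [c] may depend on
    [y]; only its modulus matters, since the multiplier in the integral absorbs it. *)
Lemma inversion_transform (k : R) (j : SL2Z -> C -> C) (f : C -> C) (y : R) :
  modular_function k j f -> 0 < y ->
  exists c : C, Cmod c = 1 /\ forall x,
    f (x, y) = (Cconj c * RtoC (Rpower (Cmod (x, y)) (- k)) * Cexp (0, k * atan (x / y))%R *
      f (- x / (x ^ 2 + y ^ 2), y / (x ^ 2 + y ^ 2))%R)%C.
Proof.
  intros Hf Hy.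
  assert (HS : forall z, denom S_mat z = z).
  { intros z. unfold denom; cbn. ring. }
  destruct (power_modulus_phase (j S_mat) k y (mf_factor_holomorphic _ _ _ Hf S_mat) Hy) as (c & Hc & Hj).
  { intros z Hz. now rewrite (mf_factor_modulus _ _ _ Hf S_mat z Hz), HS. }
  exists c; split; [easy|]. intros x.
  assert (Hm : mobius S_mat (x, y) = (- x / (x ^ 2 + y ^ 2), y / (x ^ 2 + y ^ 2))).
  { unfold mobius. rewrite HS. unfold Cdiv, Cinv, Cmult, Cplus, RtoC; cbn.
    f_equal; field; nra. }
  rewrite <- Hm, (mf_transform _ _ _ Hf S_mat (x, y) Hy), Hj.
  assert (H1 : (c * Cconj c)%C = RtoC 1) by (rewrite <- Cmod2_conj, Hc; apply f_equal; ring).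
  assert (H2 : (RtoC (Rpower (Cmod (x, y)) (- k)) * RtoC (Rpower (Cmod (x, y)) k))%C = RtoC 1).
  { rewrite <- RtoC_mult, <- Rpower_plus, Rplus_opp_l, Rpower_O; [easy|].
    apply Cmod_gt_0; intros E; injection E; lra. }
  assert (H3 : (Cexp (0, k * atan (x / y))%R * Cexp (0, - (k * atan (x / y)))%R)%C = RtoC 1).
  { rewrite <- Cexp_plus. unfold Cexp, Cplus; cbn.
    rewrite Rplus_0_l, Rplus_opp_r, exp_0, cos_0, sin_0. unfold RtoC. f_equal; ring. }
  transitivity ((c * Cconj c) * (RtoC (Rpower (Cmod (x, y)) (- k)) * RtoC (Rpower (Cmod (x, y)) k)) *
    (Cexp (0, k * atan (x / y))%R * Cexp (0, - (k * atan (x / y)))%R) * f (x, y))%C.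
  - rewrite H1, H2, H3. ring.
  - ring.
Qed.

(* Chosen so that the phase of the main term varies by at most [1] where
   [|x| <= arc_radius * s * y], [y = s^3]: the [atan] part is at most
   [|k| * arc_radius] and the cubic part at most [2 pi mu * arc_radius]. *)
Definition arc_radius (k mu : R) : R := / (1 + 2 * Rabs k + 4 * PI * mu).

Lemma arc_radius_bounds (k mu : R) : 0 < mu ->
  0 < arc_radius k mu <= 1 /\ Rabs k * arc_radius k mu <= 1 / 2 /\
  2 * PI * mu * arc_radius k mu <= 1 / 2.
Proof.
  intros Hmu. unfold arc_radius. pose proof (Rabs_pos k). pose proof PI_RGT_0.
  assert (0 < PI * mu) by now apply Rmult_lt_0_compat.
  set (D := 1 + 2 * Rabs k + 4 * PI * mu).
  assert (HD : 1 <= D) by (unfold D; lra).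
  assert (0 < / D) by (apply Rinv_0_lt_compat; lra).
  assert (D * / D = 1) by (apply Rinv_r; lra).
  unfold D in *. split; [split|split]; nra.
Qed.

(** With [y = s ^ 3] and [t = x / y], the exponent [mu / s ^ 6 = mu / y ^ 2] cancels the linear part
    of the phase and leaves [- 2 PI mu t^3 / (y (1 + t^2))]. For [|t| <= c * s] the quotient
    [t^3 / y] is at most [c ^ 3 <= c] in absolute value. *)
Lemma phase_le_1 (k mu s x : R) : 0 < mu -> 0 < s <= 1 ->
  Rabs x <= arc_radius k mu * s * s ^ 3 ->
  Rabs (k * atan (x / s ^ 3) + (2 * PI * (mu * (x / (x ^ 2 + (s ^ 3) ^ 2))) - 2 * PI * (mu / s ^ 6 * x))) <= 1.
Proof.
  intros Hmu Hs Hx.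
  destruct (arc_radius_bounds k mu Hmu) as (Hc & Hck & Hcm).
  set (c := arc_radius k mu) in *.
  assert (Hy : 0 < s ^ 3) by (apply pow_lt; lra).
  set (t := x / s ^ 3).
  assert (Hxt : x = t * s ^ 3) by (unfold t; field; lra).
  assert (Ht : Rabs t <= c * s).
  { apply (Rmult_le_reg_r (s ^ 3)); [easy|]. rewrite Hxt, Rabs_mult, (Rabs_pos_eq (s ^ 3)) in Hx by lra. exact Hx. }
  pose proof (Rabs_pos t) as Ht0. pose proof PI_RGT_0.
  assert (Ht1 : Rabs t <= c) by nra.
  assert (Hden : 0 < 1 + t ^ 2) by nra.
  replace (2 * PI * (mu * (x / (x ^ 2 + (s ^ 3) ^ 2))) - 2 * PI * (mu / s ^ 6 * x))
    with (- (2 * PI * mu * (t ^ 3 / s ^ 3 * / (1 + t ^ 2)))).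
  2:{ rewrite Hxt. field. repeat split; try lra.
      enough (0 < t ^ 2 * (s ^ 3) ^ 2 + (s ^ 3) ^ 2) by lra.
      assert (0 < (s ^ 3) ^ 2) by now apply pow_lt. nra. }
  eapply Rle_trans; [apply Rabs_triang|].
  rewrite Rabs_Ropp, !Rabs_mult.
  assert (A1 : Rabs k * Rabs (atan t) <= 1 / 2).
  { apply Rle_trans with (Rabs k * c); [|lra]. apply Rmult_le_compat_l; [apply Rabs_pos|].
    eapply Rle_trans; [apply Rabs_atan_le|lra]. }
  assert (A2 : Rabs (t ^ 3 / s ^ 3) <= c).
  { unfold Rdiv. rewrite Rabs_mult, (Rabs_pos_eq (/ s ^ 3)) by (left; now apply Rinv_0_lt_compat).
    apply (Rmult_le_reg_r (s ^ 3)); [easy|]. rewrite Rmult_assoc, Rinv_l, Rmult_1_r by lra.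
    rewrite <- RPow_abs. apply Rle_trans with ((c * s) ^ 3); [now apply pow_incr|].
    rewrite Rpow_mult_distr. apply Rmult_le_compat_r; [lra|]. simpl. nra. }
  assert (A3 : Rabs (/ (1 + t ^ 2)) <= 1).
  { rewrite Rabs_pos_eq by (left; now apply Rinv_0_lt_compat).
    rewrite <- Rinv_1. apply Rinv_le_contravar; nra. }
  rewrite (Rabs_pos_eq 2), (Rabs_pos_eq PI), (Rabs_pos_eq mu) by lra.
  enough (2 * PI * mu * (Rabs (t ^ 3 / s ^ 3) * Rabs (/ (1 + t ^ 2))) <= 1 / 2) by lra.
  apply Rle_trans with (2 * PI * mu * c); [|easy].
  apply Rmult_le_compat_l; [apply Rmult_le_pos; lra|].
  rewrite <- (Rmult_1_r c). apply Rmult_le_compat; auto using Rabs_pos.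
Qed.

(** With [t = x / s ^ 3] the loss of height against the peak [/ s ^ 3] is at most
    [t^2 / s^3 <= c^2 * s]. A bounded loss of height costs the main term only a constant factor. *)
Lemma height_near (c s x : R) : 0 < c <= 1 -> 0 < s <= 1 ->
  Rabs x <= c * s ^ 2 * s ^ 3 -> / s ^ 3 - 1 <= s ^ 3 / (x ^ 2 + (s ^ 3) ^ 2).
Proof.
  intros Hc Hs Hx.
  assert (Hy : 0 < s ^ 3) by (apply pow_lt; lra).
  assert (Hr : 0 < x ^ 2 + (s ^ 3) ^ 2) by nra.
  apply (Rmult_le_reg_r ((x ^ 2 + (s ^ 3) ^ 2) * s ^ 3)); [now apply Rmult_lt_0_compat|].
  replace (s ^ 3 / (x ^ 2 + (s ^ 3) ^ 2) * ((x ^ 2 + (s ^ 3) ^ 2) * s ^ 3)) with ((s ^ 3) ^ 2) by (field; lra).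
  replace ((/ s ^ 3 - 1) * ((x ^ 2 + (s ^ 3) ^ 2) * s ^ 3)) with ((1 - s ^ 3) * (x ^ 2 + (s ^ 3) ^ 2)) by (field; lra).
  assert (Hx2 : x ^ 2 <= s ^ 3 * (s ^ 3) ^ 2).
  { rewrite <- pow2_abs.
    apply Rle_trans with ((c * s ^ 2 * s ^ 3) ^ 2); [apply pow_incr; split; [apply Rabs_pos|easy]|].
    replace ((c * s ^ 2 * s ^ 3) ^ 2) with (c ^ 2 * s * (s ^ 3 * (s ^ 3) ^ 2)) by ring.
    assert (0 < s ^ 3 * (s ^ 3) ^ 2) by (apply Rmult_lt_0_compat; [easy|now apply pow_lt]).
    assert (Hc2 : c ^ 2 <= 1) by (rewrite <- (pow1 2); apply pow_incr; lra).
    rewrite <- (Rmult_1_l (s ^ 3 * (s ^ 3) ^ 2)) at 2. apply Rmult_le_compat_r; [lra|].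
    rewrite <- (Rmult_1_l 1). apply Rmult_le_compat; lra || apply pow2_ge_0. }
  assert (0 <= s ^ 3 * x ^ 2) by (apply Rmult_le_pos; [lra|apply pow2_ge_0]).
  lra.
Qed.

(** Rests on [1 / (1 + q) <= 1 - q / 2] for [q = (c * s)^2 <= 1]. The loss [q / (2 * s ^ 3)] is of
    order [/ s], the source of the factor [exp (- (kap / s))]. *)
Lemma height_far (c s x : R) : 0 < c <= 1 -> 0 < s <= 1 ->
  c * s * s ^ 3 <= Rabs x -> s ^ 3 / (x ^ 2 + (s ^ 3) ^ 2) <= / s ^ 3 - c ^ 2 / 2 / s.
Proof.
  intros Hc Hs Hx.
  assert (Hy : 0 < s ^ 3) by (apply pow_lt; lra).
  assert (Hx2 : c ^ 2 * s ^ 2 * (s ^ 3) ^ 2 <= x ^ 2).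
  { rewrite <- (pow2_abs x), <- !Rpow_mult_distr. apply pow_incr. split; [|easy].
    apply Rmult_le_pos; [|lra]. apply Rmult_le_pos; lra. }
  set (q := c ^ 2 * s ^ 2) in *.
  assert (Hq : 0 < q <= 1).
  { unfold q; rewrite <- Rpow_mult_distr. split; [apply pow_lt, Rmult_lt_0_compat; lra|].
    rewrite <- (pow1 2). apply pow_incr. nra. }
  replace (/ s ^ 3 - c ^ 2 / 2 / s) with ((1 - q / 2) / s ^ 3) by (unfold q; field; lra).
  apply Rle_trans with (s ^ 3 / ((1 + q) * (s ^ 3) ^ 2)).
  - apply Rmult_le_compat_l; [lra|]. apply Rinv_le_contravar; [|lra].
    apply Rmult_lt_0_compat; [lra|now apply pow_lt].
  - replace (s ^ 3 / ((1 + q) * (s ^ 3) ^ 2)) with (/ (1 + q) / s ^ 3) by (field; lra).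
    apply Rmult_le_compat_r; [left; now apply Rinv_0_lt_compat|].
    apply (Rmult_le_reg_r (1 + q)); [lra|]. rewrite Rinv_l by lra. nra.
Qed.

(** The multiplier [Cconj a0 * c] cancels the arguments of the coefficient and of the automorphy
    constant, so only the phase that varies with [x] is left in the cosine. *)
Lemma main_term_Re (a0 c : C) (P th mu lam x y : R) : Cmod c = 1 ->
  Re (Cconj a0 * c * (Cconj c * RtoC P * Cexp (0, th)%R *
     (a0 * e2pi (RtoC (- mu) * (- x / (x ^ 2 + y ^ 2), y / (x ^ 2 + y ^ 2))%R)) * e2pi (RtoC (- lam) * (x, y))))%C =
  Cmod a0 ^ 2 * P * exp (2 * PI * mu * (y / (x ^ 2 + y ^ 2)) + 2 * PI * lam * y) *
    cos (th + (2 * PI * (mu * (x / (x ^ 2 + y ^ 2))) - 2 * PI * (lam * x))).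
Proof.
  intros Hc.
  assert (H1 : (c * Cconj c)%C = RtoC 1) by (rewrite <- Cmod2_conj, Hc; apply f_equal; ring).
  set (r := x ^ 2 + y ^ 2).
  set (z1 := (RtoC (- mu) * (- x / r, y / r)%R)%C).
  set (z2 := (RtoC (- lam) * (x, y))%C).
  transitivity (Re (RtoC (Cmod a0 ^ 2) * RtoC P * (Cexp (0, th)%R * e2pi z1 * e2pi z2))%C).
  - apply (f_equal Re). rewrite Cmod2_conj.
    transitivity ((c * Cconj c) * (a0 * Cconj a0 * RtoC P * (Cexp (0, th)%R * e2pi z1 * e2pi z2)))%C; [ring|].
    rewrite H1. ring.
  - unfold e2pi. rewrite <- !Cexp_plus, <- RtoC_mult.
    match goal with |- context [Cexp ?Z] => set (Z1 := Z) end.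
    assert (HZ : Z1 = (2 * PI * mu * (y / r) + 2 * PI * lam * y,
       th + (2 * PI * (mu * (x / r)) - 2 * PI * (lam * x)))).
    { unfold Z1, z1, z2, Cplus, Cmult, RtoC, Ci; cbn. f_equal; unfold Rdiv; ring. }
    rewrite HZ. unfold Cexp, Cmult, RtoC; cbn [fst snd Re Im]. ring.
Qed.

(** As [2 * y < 1 / 4], the cases [c = 0] and [|c| = 1], [d <> 0] are excluded, for they force
    [|c x + d| >= 1 / 2]. There remain the inversion and [|c| >= 2], where the height is at most a
    quarter of the peak [/ y]. *)
Lemma denom_sq_cases (g : SL2Z) (x y : R) : 0 < y < 1 / 8 -> - (1 / 2) <= x <= 1 / 2 ->
  denom_sq g x y <= 2 * y -> denom_sq g x y = x ^ 2 + y ^ 2 \/ 4 * y ^ 2 <= denom_sq g x y.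
Proof.
  intros Hy Hx HD. unfold denom_sq in *. destruct g as [a b c d Hdet]; cbn [mc md] in *.
  assert (Hsq : forall n : Z, (2 <= Z.abs n)%Z -> 4 <= IZR n ^ 2).
  { intros n Hn. rewrite <- pow2_abs, <- abs_IZR. apply IZR_le in Hn. nra. }
  assert (Hbig : forall t, 1 / 2 <= Rabs t -> 1 / 4 <= t ^ 2).
  { intros t Ht. rewrite <- pow2_abs. nra. }
  assert (Hd1 : d <> 0%Z -> 1 <= Rabs (IZR d)).
  { intros Hd. rewrite <- abs_IZR. apply IZR_le. lia. }
  assert (Hx' : Rabs x <= 1 / 2) by (apply Rabs_le; lra).
  destruct (Z.eq_dec c 0) as [->|Hc].
  { exfalso. assert (Hd : d <> 0%Z) by (intros ->; lia). specialize (Hd1 Hd).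
    rewrite !Rmult_0_l, Rplus_0_l in HD. specialize (Hbig (IZR d)). lra. }
  destruct (Z_le_gt_dec 2 (Z.abs c)) as [Hc2|Hc2].
  { right. rewrite Rpow_mult_distr. specialize (Hsq c Hc2).
    pose proof (pow2_ge_0 (IZR c * x + IZR d)). pose proof (pow2_ge_0 y).
    assert (4 * y ^ 2 <= IZR c ^ 2 * y ^ 2) by (apply Rmult_le_compat_r; lra). lra. }
  destruct (Z.eq_dec d 0) as [->|Hd].
  { left. assert (c = 1 \/ c = -1)%Z as [-> | ->] by lia; ring. }
  exfalso. specialize (Hd1 Hd).
  assert (HR : 1 / 2 <= Rabs (IZR c * x + IZR d)).
  { pose proof (Rabs_triang_inv (IZR d) (- (IZR c * x))) as HT.
    replace (IZR d - - (IZR c * x)) with (IZR c * x + IZR d) in HT by ring.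
    rewrite Rabs_Ropp, Rabs_mult, <- (abs_IZR c) in HT.
    replace (Z.abs c) with 1%Z in HT by lia. lra. }
  specialize (Hbig _ HR). pose proof (pow2_ge_0 (IZR c * y)). lra.
Qed.

Lemma Rpower_le_1 (x p : R) : 0 < x <= 1 -> 0 <= p -> Rpower x p <= 1.
Proof.
  intros Hx Hp. replace 1 with (Rpower 1 p) by (unfold Rpower; rewrite ln_1, Rmult_0_r; apply exp_0). now apply Rle_Rpower_l.
Qed.

(** Prepares [RInt_ge_bump]. In the peak size [E], the leading term at [-1 / z] and the character
    [e2pi (- lambda z)] contribute [exp (2 PI mu / s^3)] each. The first bound holds on the whole
    period because the main term has nonnegative real part wherever it is not already negligible. *)
Lemma arc_lower_bounds (k mu : R) (j : SL2Z -> C -> C) (f : C -> C) (a : R -> C) :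
  k < 0 -> 0 < mu -> modular_function k j f ->
  expansion_at_oo (translation_constant j) f a ->
  exponents (translation_constant j) (- mu) ->
  (forall l, exponents (translation_constant j) l -> a l <> RtoC 0 -> - mu <= l) ->
  exists K kap, 0 < K /\ 0 < kap /\ forall s, 0 < s < 1 / 2 ->
    exists w, forall x, - (1 / 2) <= x <= 1 / 2 ->
      let h := Re (w * (f (x, s ^ 3)%R * e2pi (RtoC (- (mu / s ^ 6)) * (x, s ^ 3)%R)))%C in
      let E := exp (4 * PI * mu / s ^ 3) in
      let B := K * exp (- (kap / s)) * E in
      - B <= h /\
      (Rabs x <= arc_radius k mu * s ^ 5 ->
        Cmod (a (- mu)) ^ 2 / 2 * exp (- (2 * PI * mu)) * Rpower (s ^ 3) (- k) * E - B <= h).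
Proof.
  intros Hk Hmu Hf Hexp Hmem Hmin.
  set (a0 := a (- mu)).
  destruct (modular_bound k mu j f a Hk Hf Hexp Hmin) as (K & HK & HB).
  (* Exponents differ by integers, so once [- mu] is removed the remaining ones are at least
     [1 - mu]. *)
  destruct (expansion_bound _ _ _ (mu - 1) (1 / 2) (expansion_remove _ _ _ _ Hexp Hmem) ltac:(lra))
    as (K1 & HK1 & HB1).
  { intros l Hl Ha. destruct (Req_dec_T l (- mu)) as [_|Hne]; [easy|].
    specialize (Hmin l Hl Ha). destruct (exponents_diff_int _ _ _ Hmem Hl) as [n Hn].
    assert (Hn0 : 0 < IZR n) by lra. apply lt_IZR in Hn0.
    assert (1 <= IZR n) by (apply IZR_le; lia). lra. }
  fold a0 in HB1.
  pose proof PI_RGT_0 as HP.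
  assert (HPm : 0 < PI * mu) by now apply Rmult_lt_0_compat.
  destruct (arc_radius_bounds k mu Hmu) as (Hc & _ & _).
  set (c0 := arc_radius k mu) in *.
  pose proof (Cmod_ge_0 a0) as Ha0.
  (* [PI] serves the remainder, whose growth rate is lower by 1 at a height of at least
     [/ (2 * s ^ 3)]; the other entry is [2 * PI * mu] times the constant [c0 ^ 2 / 2] of
     [height_far]. *)
  set (kap := Rmin PI (PI * mu * c0 ^ 2)).
  assert (Hkap : 0 < kap).
  { apply Rmin_glb_lt; [easy|]. apply Rmult_lt_0_compat; [easy|apply pow_lt; lra]. }
  exists ((Cmod a0 + 1) * (K + K1)), kap.
  split; [apply Rmult_lt_0_compat; lra|]. split; [easy|].
  intros s Hs.
  assert (Hy : 0 < s ^ 3) by (apply pow_lt; lra).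
  assert (Hys : s ^ 3 <= s) by (simpl; nra).
  assert (Hy8 : s ^ 3 < 1 / 8) by (replace (1 / 8) with ((1 / 2) ^ 3) by lra; simpl; nra).
  destruct (inversion_transform k j f (s ^ 3) Hf Hy) as (c & Hcm & Hft).
  exists (Cconj a0 * c)%C. intros x Hx h E B.
  assert (Hw : Cmod (Cconj a0 * c)%C = Cmod a0) by (rewrite Cmod_mult, Cmod_conj, Hcm; ring).
  assert (HEs : forall q, exp q * exp (2 * PI * (mu / s ^ 6) * s ^ 3) = exp (q - 2 * PI * mu * / s ^ 3) * E).
  { intros q. unfold E. rewrite <- !exp_plus. f_equal. field. lra. }
  assert (Hsinv : / s <= / s ^ 3) by (apply Rinv_le_contravar; lra).
  assert (HE : 0 < E) by apply exp_pos.
  assert (Hkap1 : forall q, PI * / s ^ 3 <= q -> exp (- q) <= exp (- (kap / s))).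
  { intros q Hq. apply exp_monotone. apply Ropp_le_contravar. apply Rle_trans with (2 := Hq).
    apply Rmult_le_compat; try lra; [left; apply Rinv_0_lt_compat; lra|apply Rmin_l]. }
  assert (HBge : forall K', 0 <= K' <= K + K1 -> Cmod a0 * K' * exp (- (kap / s)) * E <= B).
  { intros K' HK'. unfold B. apply Rmult_le_compat_r; [lra|].
    apply Rmult_le_compat_r; [left; apply exp_pos|].
    apply Rmult_le_compat; lra. }
  (* On the near arc inversion is applied and the leading term split off; elsewhere the absolute
     bound from [modular_bound] is enough. *)
  destruct (Rle_lt_dec (Rabs x) (c0 * s * s ^ 3)) as [Hnear|Hfar].
  - set (r := x ^ 2 + (s ^ 3) ^ 2).
    set (P := Rpower (Cmod (x, s ^ 3)%R) (- k)).
    set (Y := s ^ 3 / r).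
    assert (Hxs : Rabs x <= s ^ 3).
    { apply Rle_trans with (1 := Hnear). assert (c0 * s <= 1) by nra. nra. }
    assert (Hx2 : x ^ 2 <= (s ^ 3) ^ 2) by (rewrite <- pow2_abs; apply pow_incr; split; [apply Rabs_pos|easy]).
    assert (Hy2 : 0 < (s ^ 3) ^ 2) by now apply pow_lt.
    pose proof (pow2_ge_0 x) as Hx0.
    assert (Hr : 0 < r) by (unfold r; lra).
    assert (HY1 : / (2 * s ^ 3) <= Y).
    { unfold Y. apply (Rmult_le_reg_r (2 * s ^ 3 * r)); [apply Rmult_lt_0_compat; lra|].
      replace (/ (2 * s ^ 3) * (2 * s ^ 3 * r)) with r by (field; lra).
      replace (s ^ 3 / r * (2 * s ^ 3 * r)) with (2 * (s ^ 3) ^ 2) by (field; lra). unfold r; lra. }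
    assert (HY2 : Y <= / s ^ 3).
    { unfold Y. apply (Rmult_le_reg_r (s ^ 3 * r)); [now apply Rmult_lt_0_compat|].
      replace (/ s ^ 3 * (s ^ 3 * r)) with r by (field; lra).
      replace (s ^ 3 / r * (s ^ 3 * r)) with ((s ^ 3) ^ 2) by (field; lra). unfold r; lra. }
    assert (HYh : 1 / 2 <= Y).
    { apply Rle_trans with (2 := HY1). rewrite Rinv_mult.
      assert (1 <= / s ^ 3) by (rewrite <- Rinv_1; apply Rinv_le_contravar; lra). lra. }
    assert (Hmodz : s ^ 3 <= Cmod (x, s ^ 3)%R <= 1).
    { change (Cmod (x, s ^ 3)%R) with (sqrt r). split.
      - rewrite <- (sqrt_pow2 (s ^ 3)) at 1 by lra. apply sqrt_le_1_alt. unfold r; lra.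
      - rewrite <- sqrt_1. apply sqrt_le_1_alt. unfold r. nra. }
    assert (HP0 : 0 < P) by apply exp_pos.
    assert (HP1 : P <= 1) by (apply Rpower_le_1; lra).
    set (th := k * atan (x / s ^ 3)).
    set (Rm := (f (- x / r, Y)%R - a0 * e2pi (RtoC (- mu) * (- x / r, Y)%R))%C).
    assert (HRm : Cmod Rm <= K1 * exp (2 * PI * (mu - 1) * Y)) by exact (HB1 (- x / r) Y HYh).
    set (ez := e2pi (RtoC (- (mu / s ^ 6)) * (x, s ^ 3)%R)).
    set (err := Re (Cconj a0 * c * (Cconj c * RtoC P * Cexp (0, th)%R * Rm * ez))%C).
    set (ph := th + (2 * PI * (mu * (x / r)) - 2 * PI * (mu / s ^ 6 * x))).
    set (G := exp (2 * PI * mu * Y + 2 * PI * (mu / s ^ 6) * s ^ 3)).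
    assert (Hh : h = Cmod a0 ^ 2 * P * G * cos ph + err).
    { unfold G, ph, Y, r, th. rewrite <- (main_term_Re a0 c P _ mu (mu / s ^ 6) x (s ^ 3) Hcm).
      unfold err, h. rewrite Hft.
      match goal with |- Re ?A = Re ?B1 + Re ?B2 => change (Re A = Re (B1 + B2)%C) end.
      apply (f_equal Re). unfold Rm. fold r. fold Y. fold ez. fold P. fold th. ring. }
    assert (Herr : Rabs err <= B).
    { apply Rle_trans with (2 := HBge K1 ltac:(lra)).
      unfold err. eapply Rle_trans; [apply re_le_Cmod|].
      rewrite Cmod_mult, Hw, !Cmod_mult, Cmod_conj, Hcm, Cmod_R, Cmod_Cexp. cbn [Re fst].
      rewrite exp_0, (Rabs_pos_eq P) by lra. unfold ez. rewrite Cmod_e2pi, scal_pair. cbn [Im snd].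
      replace (- (2 * PI * (- (mu / s ^ 6) * s ^ 3))) with (2 * PI * (mu / s ^ 6) * s ^ 3) by ring.
      rewrite !Rmult_1_l, Rmult_1_r, !(Rmult_assoc (Cmod a0)).
      apply Rmult_le_compat_l; [easy|].
      apply Rle_trans with (1 * (K1 * exp (2 * PI * (mu - 1) * Y)) * exp (2 * PI * (mu / s ^ 6) * s ^ 3)).
      - apply Rmult_le_compat_r; [left; apply exp_pos|].
        apply Rmult_le_compat; [lra|apply Cmod_ge_0|lra|exact HRm].
      - rewrite Rmult_1_l, Rmult_assoc, HEs, <- Rmult_assoc.
        apply Rmult_le_compat_r; [lra|]. apply Rmult_le_compat_l; [lra|].
        replace (2 * PI * (mu - 1) * Y - 2 * PI * mu * / s ^ 3) with (- (2 * PI * Y + 2 * (PI * mu) * (/ s ^ 3 - Y))) by ring.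
        apply Hkap1. rewrite Rinv_mult in HY1.
        assert (0 <= PI * mu * (/ s ^ 3 - Y)) by (apply Rmult_le_pos; lra).
        assert (PI * / s ^ 3 <= PI * (2 * Y)) by (apply Rmult_le_compat_l; lra). lra. }
    assert (Hcos : 1 / 2 <= cos ph) by (apply cos_ge_half, phase_le_1; [easy|lra|easy]).
    assert (HG : 0 < G) by apply exp_pos.
    assert (Hm : Cmod a0 ^ 2 * P * G * (1 / 2) <= Cmod a0 ^ 2 * P * G * cos ph).
    { apply Rmult_le_compat_l; [|easy]. apply Rmult_le_pos; [|lra].
      apply Rmult_le_pos; [apply pow2_ge_0|lra]. }
    assert (Herr' : - B <= err) by (pose proof (Rle_abs (- err)); rewrite Rabs_Ropp in *; lra).
    pose proof (pow2_ge_0 (Cmod a0)) as Ha2.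
    split.
    + assert (0 <= Cmod a0 ^ 2 * P * G) by (apply Rmult_le_pos; [apply Rmult_le_pos|]; lra). lra.
    + intros Hx5.
      assert (HYn : / s ^ 3 - 1 <= Y).
      { unfold Y, r. apply (height_near c0); [easy|lra|]. replace (c0 * s ^ 2 * s ^ 3) with (c0 * s ^ 5) by ring. easy. }
      assert (HGE : exp (- (2 * PI * mu)) * E <= G).
      { unfold G. rewrite exp_plus, HEs. apply Rmult_le_compat_r; [lra|]. apply exp_monotone.
        assert (0 <= PI * mu * (Y - (/ s ^ 3 - 1))) by (apply Rmult_le_pos; lra). lra. }
      assert (HPs : Rpower (s ^ 3) (- k) <= P) by (apply Rle_Rpower_l; lra).
      assert (Cmod a0 ^ 2 * (Rpower (s ^ 3) (- k) * (exp (- (2 * PI * mu)) * E)) <= Cmod a0 ^ 2 * (P * G)).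
      { apply Rmult_le_compat_l; [easy|]. apply Rmult_le_compat; try easy.
        - left; apply exp_pos.
        - apply Rmult_le_pos; [left; apply exp_pos|lra]. }
      lra.
  - assert (Hh : - B <= h).
    { enough (Rabs h <= B) by (pose proof (Rle_abs (- h)); rewrite Rabs_Ropp in *; lra).
      apply Rle_trans with (2 := HBge K ltac:(lra)).
      unfold h. eapply Rle_trans; [apply re_le_Cmod|].
      rewrite Cmod_mult, Hw, Cmod_mult, Cmod_e2pi, scal_pair. cbn [Im snd].
      replace (- (2 * PI * (- (mu / s ^ 6) * s ^ 3))) with (2 * PI * (mu / s ^ 6) * s ^ 3) by ring.
      rewrite !(Rmult_assoc (Cmod a0)). apply Rmult_le_compat_l; [easy|].
      destruct (HB x (s ^ 3) Hy) as (g & Hg & Hfg).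
      assert (HD : s ^ 3 / denom_sq g x (s ^ 3) <= / s ^ 3 - c0 ^ 2 / 2 / s).
      { destruct (denom_sq_cases g x (s ^ 3) ltac:(lra) Hx Hg) as [->|H4].
        - apply height_far; [easy|lra|lra].
        (* The loss claimed is at most half of [/ s ^ 3], so a quarter of the peak height stays
           below the bound. *)
        - apply Rle_trans with (/ 4 * / s ^ 3).
          + apply Rle_trans with (s ^ 3 / (4 * (s ^ 3) ^ 2)).
            * apply Rmult_le_compat_l; [lra|]. apply Rinv_le_contravar; [|easy].
              apply Rmult_lt_0_compat; [lra|now apply pow_lt].
            * right. field. lra.
          + assert (0 < / s) by (apply Rinv_0_lt_compat; lra).
            assert (c0 ^ 2 / 2 / s <= 1 / 2 * / s).
            { apply Rmult_le_compat_r; [lra|]. assert (c0 ^ 2 <= 1) by (rewrite <- (pow1 2); apply pow_incr; lra). lra. }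
            lra. }
      apply Rle_trans with (K * exp (2 * PI * mu * (s ^ 3 / denom_sq g x (s ^ 3))) * exp (2 * PI * (mu / s ^ 6) * s ^ 3)).
      - apply Rmult_le_compat_r; [left; apply exp_pos|].
        apply Rle_trans with (1 := Hfg). apply Rmult_le_compat_r; [left; apply exp_pos|].
        rewrite <- (Rmult_1_r K) at 2. apply Rmult_le_compat_l; [lra|].
        apply Rpower_le_1; [|lra]. split; [apply sqrt_lt_R0; lra|].
        rewrite <- sqrt_1. apply sqrt_le_1_alt. lra.
      - rewrite Rmult_assoc, HEs, <- Rmult_assoc.
        apply Rmult_le_compat_r; [lra|]. apply Rmult_le_compat_l; [lra|].
        apply exp_monotone. set (q := s ^ 3 / _) in *.
        assert (kap / s <= PI * mu * c0 ^ 2 / s).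
        { apply Rmult_le_compat_r; [left; apply Rinv_0_lt_compat; lra|apply Rmin_r]. }
        assert (0 <= PI * mu * (/ s ^ 3 - c0 ^ 2 / 2 / s - q)) by (apply Rmult_le_pos; lra).
        replace (PI * mu * (/ s ^ 3 - c0 ^ 2 / 2 / s - q)) with
          (PI * mu * / s ^ 3 - (PI * mu * c0 ^ 2 / s) / 2 - PI * mu * q) in * by (field; lra).
        lra. }
    split; [easy|]. intros Hx5. exfalso.
    assert (c0 * s ^ 5 <= c0 * s * s ^ 3); [|lra].
    replace (c0 * s ^ 5) with (c0 * s * s ^ 3 * s) by ring.
    assert (0 < c0 * s * s ^ 3) by (apply Rmult_lt_0_compat; [apply Rmult_lt_0_compat|]; lra). nra.
Qed.

(** * Non-vanishing of the coefficients with large exponent *)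

Theorem corollary2 :
  forall (k : R) (j : SL2Z -> C -> C) (f : C -> C) (a : R -> C),
    k < 0 ->
    modular_function k j f ->
    (exists z : C, upper_half_plane z /\ f z <> RtoC 0) ->
    expansion_at_oo (translation_constant j) f a ->
    exists lambda0 : R, forall lambda : R,
      exponents (translation_constant j) lambda ->
      lambda0 <= lambda ->
      a lambda <> RtoC 0.
Proof.
  intros k j f a Hk Hf Hnz Hexp.
  destruct (mf_finite_order _ _ _ Hf) as (a' & Hexp' & L & HL).
  set (u := translation_constant j) in *.
  assert (Haa : forall l, exponents u l -> a' l = a l).
  { intros l Hl. now apply (coefficient_unique u f a' a l (mf_holomorphic _ _ _ Hf)). }
  destruct (exists_least_in_list (fun l => exponents u l /\ l < 0 /\ a l <> RtoC 0) L)
    as (m & _ & (Hmu & Hm0 & Ham) & Hleast).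
  { destruct (exists_negative_exponent k j f a Hk Hf Hnz Hexp) as (l & Hl & Hl0 & Hal).
    exists l. split; [|tauto]. apply HL; [easy|easy|]. now rewrite Haa. }
  set (mu := - m).
  replace m with (- mu) in Hmu, Ham by (unfold mu; ring).
  assert (Hmup : 0 < mu) by (unfold mu; lra).
  assert (Hmin : forall l, exponents u l -> a l <> RtoC 0 -> - mu <= l).
  { intros l Hl Hal. replace (- mu) with m by (unfold mu; ring).
    destruct (Rle_lt_dec 0 l) as [H0|H0]; [lra|].
    apply Hleast; [|tauto]. apply HL; [easy|easy|]. now rewrite Haa. }
  destruct (arc_lower_bounds k mu j f a Hk Hmup Hf Hexp Hmu Hmin) as (K & kap & HK & Hkap & Harc).
  destruct (arc_radius_bounds k mu Hmup) as (Hc & _ & _).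
  set (c0 := arc_radius k mu) in *.
  set (b := Cmod (a (- mu)) ^ 2 / 2 * exp (- (2 * PI * mu))) in *.
  assert (Hb : 0 < b).
  { apply Cmod_gt_0 in Ham. apply Rmult_lt_0_compat; [|apply exp_pos].
    assert (0 < Cmod (a (- mu)) ^ 2) by now apply pow_lt. lra. }
  destruct (exists_pow2_ge (- k)) as [N0 HN0].
  set (N := (2 ^ N0)%nat).
  assert (HN : - k <= INR N) by (unfold N; rewrite pow_INR; exact HN0).
  (* The inner arc has length [2 * c0 * s ^ 5] and the main term there is at least [b * s ^ (3 * N)]
     times [E], against the loss [K * exp (- (kap / s))] times [E]. *)
  destruct (exp_neg_inv_lt_pow (K / (2 * c0 * b)) kap (3 * N + 5)) as (s0 & Hs0 & Hsmall).
  { apply Rdiv_lt_0_compat; [easy|]. apply Rmult_lt_0_compat; lra. }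
  { easy. }
  set (s1 := Rmin s0 (1 / 2)).
  assert (Hs1 : 0 < s1) by (apply Rmin_glb_lt; lra).
  assert (Hs16 : 0 < s1 ^ 6) by now apply pow_lt.
  (* The saddle-point height [s ^ 3 = sqrt (mu / lam)] makes [s] the sixth root of [mu / lam];
     [lam > mu / s1 ^ 6] then means [s < s1], and the [+ 1] makes this strict. *)
  exists (mu / s1 ^ 6 + 1). intros lam Hlam Hge Hzero.
  assert (Hq : 0 < mu / s1 ^ 6) by now apply Rdiv_lt_0_compat.
  set (s := Rpower (mu / lam) (/ INR 6)).
  assert (Hml : 0 < mu / lam) by (apply Rdiv_lt_0_compat; lra).
  assert (Hs : 0 < s) by apply exp_pos.
  assert (Hs6 : s ^ 6 = mu / lam).
  { unfold s. rewrite <- Rpower_pow by apply exp_pos. rewrite Rpower_mult, Rinv_l, Rpower_1; [easy|easy|].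
    apply not_0_INR; lia. }
  assert (Hss1 : s < s1).
  { apply Rnot_le_lt; intros Hle.
    assert (Hp : s1 ^ 6 <= s ^ 6) by (apply pow_incr; lra). rewrite Hs6 in Hp.
    apply (Rmult_le_compat_r (lam / s1 ^ 6)) in Hp; [|left; apply Rdiv_lt_0_compat; lra].
    replace (s1 ^ 6 * (lam / s1 ^ 6)) with lam in Hp by (field; lra).
    replace (mu / lam * (lam / s1 ^ 6)) with (mu / s1 ^ 6) in Hp by (field; lra). lra. }
  assert (Hlams : lam = mu / s ^ 6) by (rewrite Hs6; field; lra).
  assert (Hss0 : s < s0) by (apply Rlt_le_trans with (1 := Hss1), Rmin_l).
  assert (Hs2 : s < 1 / 2) by (apply Rlt_le_trans with (1 := Hss1), Rmin_r).
  destruct (Harc s (conj Hs Hs2)) as (w & Hw). rewrite <- Hlams in Hw. cbv zeta in Hw.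
  assert (Hy : 0 < s ^ 3) by now apply pow_lt.
  pose proof (continuous_coefficient_integrand f w (s ^ 3) lam (mf_holomorphic _ _ _ Hf) Hy) as Hcont.
  pose proof (coefficient_integral u f a (s ^ 3) lam w Hexp Hy Hlam Hcont) as HI.
  rewrite Hzero, Cmult_0_r in HI. cbn [Re RtoC fst] in HI.
  set (E := exp (4 * PI * mu / s ^ 3)) in *.
  assert (HE : 0 < E) by apply exp_pos.
  assert (Hd : 0 < c0 * s ^ 5 < 1 / 2).
  { assert (0 < s ^ 5) by now apply pow_lt.
    assert (s ^ 5 < 1 / 2) by (replace (s ^ 5) with (s * s ^ 4) by ring;
      assert (s ^ 4 <= 1) by (rewrite <- (pow1 4); apply pow_incr; lra); nra).
    split; [apply Rmult_lt_0_compat; lra|nra]. }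
  assert (Hbump := RInt_ge_bump _ (b * Rpower (s ^ 3) (- k) * E) (K * exp (- (kap / s)) * E) (c0 * s ^ 5)
    Hcont Hd (fun x Hx => proj1 (Hw x Hx))).
  rewrite HI in Hbump.
  assert (Hb2 : 2 * (c0 * s ^ 5) * (b * Rpower (s ^ 3) (- k) * E) - K * exp (- (kap / s)) * E <= 0).
  { apply Hbump. intros x Hx. apply Hw; [|easy].
    pose proof (Rle_abs x). pose proof (Rle_abs (- x)). rewrite Rabs_Ropp in *. lra. }
  assert (HRp : s ^ (3 * N) <= Rpower (s ^ 3) (- k)).
  { rewrite pow_mult, <- Rpower_pow by easy. unfold Rpower. apply exp_monotone.
    assert (ln (s ^ 3) <= 0).
    { rewrite <- ln_1. left. apply ln_increasing; [easy|]. simpl. nra. }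
    nra. }
  specialize (Hsmall s (conj Hs Hss0)).
  assert (Hcb : 0 < 2 * c0 * b) by (apply Rmult_lt_0_compat; lra).
  apply (Rmult_lt_compat_l (2 * c0 * b)) in Hsmall; [|easy].
  replace (2 * c0 * b * (K / (2 * c0 * b) * exp (- (kap / s)))) with (K * exp (- (kap / s))) in Hsmall by (field; lra).
  rewrite pow_add in Hsmall.
  assert (Hlow : 2 * c0 * b * (s ^ (3 * N) * s ^ 5) <= 2 * (c0 * s ^ 5) * (b * Rpower (s ^ 3) (- k))).
  { replace (2 * (c0 * s ^ 5) * (b * Rpower (s ^ 3) (- k))) with (2 * c0 * b * (Rpower (s ^ 3) (- k) * s ^ 5)) by ring.
    apply Rmult_le_compat_l; [lra|]. apply Rmult_le_compat_r; [apply pow_le; lra|easy]. }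
  assert (0 < (2 * (c0 * s ^ 5) * (b * Rpower (s ^ 3) (- k)) - K * exp (- (kap / s))) * E)
    by (apply Rmult_lt_0_compat; lra).
  lra.
Qed.
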